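(* Let $k$ be a field of characteristic $p>0$, let $r$ and $s$ be non-negative integers, and let $I\subset H^*(\mathcal{E}_{r,s},k)$ be a homogeneous ideal which is stable under the Steenrod operations. If $I$ contains a non-zero element of degree two, then there exist a non-negative integer $m$ and a finite (possibly empty) family $\{u_i\}$ of elements in $H^2(E_s,k)\subset H^2(\mathcal{E}_{r,s},k)$, each of which is a non-zero $k$-linear combination of the $\{z_j\}$, such that the product $x_r^m\prod u_i\in H^*(\mathcal{E}_{r,s},k)$ lies in $I$ (where $x_r^m$ is read as $1$ if $r=0$).
   Context: $\mathcal{E}_{r,s}=\mathbb{G}_{a(r)}\times E_s$ over $k$, where $\mathbb{G}_{a(r)}$ is the $r$th Frobenius kernel of the additive group scheme $\mathbb{G}_a$ and $E_s=(\mathbb{Z}/p)^s$ is the elementary abelian $p$-group of rank $s$ regarded as a constant group scheme; $\mathbb{G}_{a(0)}$ and $E_0$ are trivial. One has $H^*(\mathcal{E}_{r,s},k)=H^*(\mathbb{G}_{a(r)},k)\otimes H^*(E_s,k)$. If $p\neq2$, then $H^*(\mathbb{G}_{a(r)},k)=k[x_1,\dots,x_r]\otimes\Lambda(\lambda_1,\dots,\lambda_r)$ and $H^*(E_s,k)=k[z_1,\dots,z_s]\otimes\Lambda(y_1,\dots,y_s)$ with $x_i,z_i$ of degree $2$ and $\lambda_i,y_i$ of degree $1$. If $p=2$, then $H^*(\mathbb{G}_{a(r)},k)=k[\lambda_1,\dots,\lambda_r]$ and $H^*(E_s,k)=k[y_1,\dots,y_s]$ with $\lambda_i,y_i$ of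 degree $1$, and one sets $x_i=\lambda_i^2$, $z_i=y_i^2$. The Steenrod operations on the cohomology of a finite dimensional cocommutative Hopf algebra are additive and $p$-semilinear over $k$ (they carry $au$ to $a^p$ times the operation on $u$, for $a\in k$). For $p>2$ they are $\mathcal{P}^j:H^n\to H^{n+2j(p-1)}$ and $\beta\mathcal{P}^j:H^n\to H^{n+2j(p-1)+1}$ ($j\ge0$), satisfying the Cartan formulas $\mathcal{P}^\ell(uv)=\sum_{n=0}^{\ell}\mathcal{P}^n(u)\mathcal{P}^{\ell-n}(v)$ and $\beta\mathcal{P}^\ell(uv)=\sum_{n=0}^{\ell}\big(\beta\mathcal{P}^n(u)\mathcal{P}^{\ell-n}(v)+(-1)^{\deg u}\mathcal{P}^n(u)\beta\mathcal{P}^{\ell-n}(v)\big)$. For $p=2$ they are $Sq^j:H^n\to H^{n+j}$ ($j\ge0$) satisfying $Sq^\ell(uv)=\sum_{n=0}^{\ell}Sq^n(u)Sq^{\ell-n}(v)$. On $H^*(\mathcal{E}_{r,s},k)$ they are determined by these properties and the following values on generators (with $x_{r+1}=\lambda_{r+1}=0$). For $p>2$: $\mathcal{P}^0(x_i)=x_{i+1}$, $\mathcal{P}^0(\lambda_i)=\lambda_{i+1}$, $\mathcal{P}^0(z_i)=z_i$, $\mathcal{P}^0(y_i)=y_i$; $\mathcal{P}^1(x_i)=x_i^p$, $\mathcal{P}^1(z_i)=z_i^p$; $\mathcal{P}^j(x_i)=\mathcal{P}^j(z_i)=0$ for $j>1$; $\mathcal{P}^j(\lambda_i)=\mathcal{P}^j(y_i)=0$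 for $j\ge1$; $\beta\mathcal{P}^0(\lambda_i)=-x_i$, $\beta\mathcal{P}^0(y_i)=z_i$, $\beta\mathcal{P}^0(x_i)=\beta\mathcal{P}^0(z_i)=0$; $\beta\mathcal{P}^j$ vanishes on all $x_i,z_i,\lambda_i,y_i$ for $j\ge1$. For $p=2$: $Sq^0(\lambda_i)=\lambda_{i+1}$, $Sq^0(y_i)=y_i$, $Sq^1(\lambda_i)=\lambda_i^2=x_i$, $Sq^1(y_i)=y_i^2=z_i$, and $Sq^j(\lambda_i)=Sq^j(y_i)=0$ for $j>1$. ''Stable under the Steenrod operations'' means mapped into itself by all $\mathcal{P}^j,\beta\mathcal{P}^j$ (for $p>2$) or all $Sq^j$ (for $p=2$). *)

(* Defs.v *)
From HB Require Import structures.
From mathcomp Require Import all_boot all_order all_algebra.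
From mathcomp Require Import mpoly.

Set Implicit Arguments.
Unset Strict Implicit.
Unset Printing Implicit Defensive.

Import GRing.Theory.
Local Open Scope ring_scope.

(** * The graded-commutative algebra R[X_0..X_(n-1)] (x) /\(e_0..e_(n-1)) *)

(** An element is sum_S (f S) e_S, where S runs over the subsets of 'I_n, f S is
    a polynomial in the X_i, and e_S is the product of the e_i for i in S taken
    in increasing order. *)
Definition extpoly (R : comNzRingType) (n : nat) :=
  {ffun {set 'I_n} -> {mpoly R[n]}}.

(** Number of transpositions needed to sort e_S e_T into e_(S :|: T). *)
Definition inversions (n : nat) (S T : {set 'I_n}) : nat :=
  (\sum_(i in S) \sum_(j in T) (j < i))%N.

Section ExtPoly.
Variables (R : comNzRingType) (n : nat).
Local Notation H := (extpoly R n).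
Implicit Types (f g h : H) (S T U : {set 'I_n}) (a b c : {mpoly R[n]}).

(** [a e_S] *)
Definition ext_term a S : H := [ffun U => a *+ (U == S)].

Definition ext_one : H := ext_term 1 set0.

Definition ext_mul f g : H :=
  [ffun U => \sum_(S : {set 'I_n}) \sum_(T : {set 'I_n} | [disjoint S & T] && (S :|: T == U))
               (-1) ^+ inversions S T * f S * g T].

HB.instance Definition _ := GRing.Lmodule.on H.

Fact ext_mulDl : left_distributive ext_mul +%R.
Proof.
move=> f g h; apply/ffunP=> U; rewrite !ffunE -big_split /=.
apply: eq_bigr => S _; rewrite -big_split /=; apply: eq_bigr => T _.
by rewrite !ffunE mulrDr mulrDl.
Qed.

Fact ext_mulDr : right_distributive ext_mul +%R.
Proof.
move=> f g h; apply/ffunP=> U; rewrite !ffunE -big_split /=.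
apply: eq_bigr => S _; rewrite -big_split /=; apply: eq_bigr => T _.
by rewrite !ffunE mulrDr.
Qed.

Fact ext_mul0l g : ext_mul 0 g = 0.
Proof.
apply/ffunP=> U; rewrite !ffunE big1 // => S _; rewrite big1 // => T _.
by rewrite ffunE mulr0 mul0r.
Qed.

Fact ext_mul0r f : ext_mul f 0 = 0.
Proof.
apply/ffunP=> U; rewrite !ffunE big1 // => S _; rewrite big1 // => T _.
by rewrite ffunE mulr0.
Qed.

Fact ext_sum_terms f : f = \sum_S ext_term (f S) S.
Proof.
apply/ffunP=> U; rewrite sum_ffunE (bigD1 U) //= ffunE eqxx mulr1n big1 ?addr0 //.
by move=> S neSU; rewrite ffunE eq_sym (negPf neSU).
Qed.

Definition ext_sign S T : {mpoly R[n]} :=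
  if [disjoint S & T] then (-1) ^+ inversions S T else 0.

Fact ext_mul_term a b S T :
  ext_mul (ext_term a S) (ext_term b T)
  = ext_term (ext_sign S T * a * b) (S :|: T).
Proof.
apply/ffunP=> U; rewrite !ffunE (bigD1 S) //= [X in _ + X]big1 ?addr0; last first.
  move=> S' neS; rewrite big1 // => T' _.
  by rewrite ffunE (negPf neS) mulr0n mulr0 mul0r.
rewrite big_mkcond (bigD1 T) //= [X in _ + X]big1 ?addr0; last first.
  move=> T' neT; case: ifP => // _.
  by rewrite [ext_term b T _]ffunE (negPf neT) mulr0.
rewrite !ffunE !eqxx !mulr1n /ext_sign eq_sym.
case: ifP => [/andP[-> ->]|]; first by rewrite mulr1n.
by case: disjoint => /= [->|]; rewrite ?mulr0n ?mul0r ?mul0rn.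
Qed.

Fact inversionsUl S T U : [disjoint S & T] ->
  inversions (S :|: T) U = (inversions S U + inversions T U)%N.
Proof.
move=> dST; rewrite /inversions -bigU //.
by apply: eq_bigl => i; rewrite !inE.
Qed.

Fact inversionsUr S T U : [disjoint T & U] ->
  inversions S (T :|: U) = (inversions S T + inversions S U)%N.
Proof.
move=> dTU; rewrite /inversions -big_split; apply: eq_bigr => i _.
by rewrite -bigU //; apply: eq_bigl => j; rewrite !inE.
Qed.

Fact ext_sign_assoc S T U :
  ext_sign T U * ext_sign S (T :|: U) = ext_sign S T * ext_sign (S :|: T) U.
Proof.
rewrite /ext_sign !disjoints_subset subUset setCU subsetI -!disjoints_subset.
case dST: [disjoint S & T]; case dTU: [disjoint T & U];
  case dSU: [disjoint S & U]; rewrite /= ?mul0r ?mulr0 //.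
by rewrite inversionsUl // inversionsUr // !exprD mulrC mulrA mulrAC -mulrA.
Qed.

Fact ext_ind (K : H -> Prop) : K 0 -> (forall f g, K f -> K g -> K (f + g)) ->
  (forall a S, K (ext_term a S)) -> forall f, K f.
Proof. move=> K0 KD Kt f; rewrite (ext_sum_terms f); by apply: (big_ind K) => // S _; exact: Kt. Qed.

Fact ext_mulA : associative ext_mul.
Proof.
move=> f g h; elim/ext_ind: f => [|f1 f2 IH1 IH2|a S]; first by rewrite !ext_mul0l.
  by rewrite !ext_mulDl IH1 IH2.
elim/ext_ind: g => [|g1 g2 IH1 IH2|b T]; first by rewrite !(ext_mul0l, ext_mul0r).
  by rewrite !(ext_mulDl, ext_mulDr) IH1 IH2.
elim/ext_ind: h => [|h1 h2 IH1 IH2|c U]; first by rewrite !ext_mul0r.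
  by rewrite !ext_mulDr IH1 IH2.
rewrite !ext_mul_term setUA; congr ext_term.
rewrite !mulrA [_ * a * _]mulrAC [ext_sign S (T :|: U) * _]mulrC.
by rewrite ext_sign_assoc [ext_sign _ U * _]mulrC.
Qed.

Fact ext_mul1l : left_id ext_one ext_mul.
Proof.
move=> f; elim/ext_ind: f => [|f g IHf IHg|a S]; first by rewrite ext_mul0r.
  by rewrite ext_mulDr IHf IHg.
rewrite ext_mul_term set0U /ext_sign -setI_eq0 set0I eqxx.
by rewrite /inversions big_set0 expr0 !mul1r.
Qed.

Fact ext_mul1r : right_id ext_one ext_mul.
Proof.
move=> f; elim/ext_ind: f => [|f g IHf IHg|a S]; first by rewrite ext_mul0l.
  by rewrite ext_mulDl IHf IHg.
rewrite ext_mul_term setU0 /ext_sign -setI_eq0 setI0 eqxx.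
by rewrite /inversions big1 ?expr0 ?mul1r ?mulr1 // => i _; rewrite big_set0.
Qed.

Fact ext_one_neq0 : ext_one != 0.
Proof.
apply/eqP=> /ffunP/(_ set0)/eqP; rewrite !ffunE eqxx mulr1n.
exact/negP/oner_neq0.
Qed.

HB.instance Definition _ := GRing.Zmodule_isNzRing.Build H
  ext_mulA ext_mul1l ext_mul1r ext_mulDl ext_mulDr ext_one_neq0.

Fact ext_scalerAl (a : R) f g : a *: (f * g) = (a *: f) * g.
Proof.
apply/ffunP=> U; rewrite !ffunE scaler_sumr; apply: eq_bigr => S _.
rewrite scaler_sumr; apply: eq_bigr => T _.
by rewrite ffunE -scalerAr -scalerAl.
Qed.

HB.instance Definition _ := GRing.Lmodule_isLalgebra.Build R H ext_scalerAl.

Fact ext_scalerAr (a : R) f g : a *: (f * g) = f * (a *: g).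
Proof.
apply/ffunP=> U; rewrite !ffunE scaler_sumr; apply: eq_bigr => S _.
rewrite scaler_sumr; apply: eq_bigr => T _.
by rewrite ffunE -scalerAr.
Qed.

HB.instance Definition _ := GRing.Lalgebra_isAlgebra.Build R H ext_scalerAr.

(** The generators: X_i in degree 2 and e_i in degree 1. *)
Definition ext_X (i : 'I_n) : H := ext_term 'X_i set0.
Definition ext_e (i : 'I_n) : H := ext_term 1 [set i].

Definition ext_homog (d : nat) f : Prop :=
  forall (S : {set 'I_n}) (m : 'X_{1..n}),
    m \in msupp (f S) -> (2 * mdeg m + #|S|)%N = d.

End ExtPoly.

(** * Ideals of a graded algebra *)

Section GradedIdeals.
Variables (k : fieldType) (A : algType k) (grade : nat -> A -> Prop).
Implicit Types (I : A -> Prop) (F : A -> A).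

Definition is_ideal I : Prop :=
  [/\ I 0, forall u v, I u -> I v -> I (u + v)
    & forall a u, I u -> I (a * u) /\ I (u * a)].

(** Every element of I is a sum of homogeneous elements of I. *)
Definition is_homogeneous I : Prop :=
  forall u, I u -> exists (N : nat) (v : nat -> A),
    (forall d, grade d (v d) /\ I (v d)) /\ u = \sum_(d < N) v d.

Definition stable_under F I : Prop := forall u, I u -> I (F u).

Definition semilinear_map (p : nat) F : Prop :=
  {morph F : u v / u + v} /\ forall (a : k) u, F (a *: u) = a ^+ p *: F u.

(** [x] and [z] are the polynomial generators in degree 2, with x_i written
    [x i.-1] and [z] indexed by 'I_s. *)
Definition contains_product (r s : nat) (x : nat -> A) (z : 'I_s -> A) I : Prop :=
  exists (m : nat) (us : seq A),
    (forall u, u \in us ->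
       u != 0 /\ exists c : 'I_s -> k, u = \sum_(j < s) c j *: z j)
    /\ I ((if r is r'.+1 then x r' ^+ m else 1) * \prod_(u <- us) u).

End GradedIdeals.

(** * The cohomology of G_a(r) x (Z/p)^s for p odd *)

(** The graded tensor product of k[x] (x) /\(lambda) and k[z] (x) /\(y): the first
    r variables come from G_a(r) and the last s from (Z/p)^s. The generators
    x_1, ..., x_r and lambda_1, ..., lambda_r are indexed from 0, and vanish from
    index r on. *)
Notation Hodd k r s := (extpoly k (r + s)).

Section OddCohomology.
Variables (k : fieldType) (r s : nat).
Local Notation Hodd := (Hodd k r s).

Definition odd_x (i : nat) : Hodd :=
  if insub i is Some i' then ext_X k (lshift s i') else 0.
Definition odd_lambda (i : nat) : Hodd :=
  if insub i is Some i' then ext_e k (lshift s i') else 0.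
Definition odd_z (j : 'I_s) : Hodd := ext_X k (rshift r j).
Definition odd_y (j : 'I_s) : Hodd := ext_e k (rshift r j).

Definition odd_homog (d : nat) (u : Hodd) : Prop := ext_homog d u.

(** The Steenrod operations P^j and (beta P)^j, extended additively from the
    homogeneous components to the whole cohomology. *)
Record steenrod_odd (p : nat) (P bP : nat -> Hodd -> Hodd) : Prop := {
  P_semilinear : forall j, semilinear_map p (P j);
  bP_semilinear : forall j, semilinear_map p (bP j);
  P_homog : forall j d u, odd_homog d u ->
    odd_homog (d + 2 * j * (p - 1))%N (P j u);
  bP_homog : forall j d u, odd_homog d u ->
    odd_homog (d + 2 * j * (p - 1) + 1)%N (bP j u);
  P_cartan : forall l u v,
    P l (u * v) = \sum_(n < l.+1) P n u * P (l - n)%N v;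
  bP_cartan : forall l d u v, odd_homog d u ->
    bP l (u * v) = \sum_(n < l.+1) (bP n u * P (l - n)%N v
                                    + (-1) ^+ d * (P n u * bP (l - n)%N v));
  P0_x : forall i, (i < r)%N -> P 0%N (odd_x i) = odd_x i.+1;
  P0_lambda : forall i, (i < r)%N -> P 0%N (odd_lambda i) = odd_lambda i.+1;
  P0_z : forall j, P 0%N (odd_z j) = odd_z j;
  P0_y : forall j, P 0%N (odd_y j) = odd_y j;
  P1_x : forall i, (i < r)%N -> P 1%N (odd_x i) = odd_x i ^+ p;
  P1_z : forall j, P 1%N (odd_z j) = odd_z j ^+ p;
  Pn_x : forall n i, (1 < n)%N -> (i < r)%N -> P n (odd_x i) = 0;
  Pn_z : forall n j, (1 < n)%N -> P n (odd_z j) = 0;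
  Pn_lambda : forall n i, (0 < n)%N -> (i < r)%N -> P n (odd_lambda i) = 0;
  Pn_y : forall n j, (0 < n)%N -> P n (odd_y j) = 0;
  bP0_lambda : forall i, (i < r)%N -> bP 0%N (odd_lambda i) = - odd_x i;
  bP0_y : forall j, bP 0%N (odd_y j) = odd_z j;
  bP0_x : forall i, (i < r)%N -> bP 0%N (odd_x i) = 0;
  bP0_z : forall j, bP 0%N (odd_z j) = 0;
  bPn_x : forall n i, (0 < n)%N -> (i < r)%N -> bP n (odd_x i) = 0;
  bPn_z : forall n j, (0 < n)%N -> bP n (odd_z j) = 0;
  bPn_lambda : forall n i, (0 < n)%N -> (i < r)%N -> bP n (odd_lambda i) = 0;
  bPn_y : forall n j, (0 < n)%N -> bP n (odd_y j) = 0 }.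

End OddCohomology.

(** * The cohomology of G_a(r) x (Z/2)^s for p = 2 *)

(** A polynomial ring on generators of degree 1, with the same indexing. *)
Notation Htwo k r s := {mpoly k[r + s]}.

Section TwoCohomology.
Variables (k : fieldType) (r s : nat).
Local Notation Htwo := (Htwo k r s).

Definition two_lambda (i : nat) : Htwo :=
  if insub i is Some i' then 'X_(lshift s i') else 0.
Definition two_y (j : 'I_s) : Htwo := 'X_(rshift r j).
Definition two_x (i : nat) : Htwo := two_lambda i ^+ 2.
Definition two_z (j : 'I_s) : Htwo := two_y j ^+ 2.

Definition two_homog (d : nat) (u : Htwo) : Prop := u \is d.-homog.

Record steenrod_two (Sq : nat -> Htwo -> Htwo) : Prop := {
  Sq_semilinear : forall j, semilinear_map 2 (Sq j);
  Sq_homog : forall j d u, two_homog d u -> two_homog (d + j)%N (Sq j u);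
  Sq_cartan : forall l u v,
    Sq l (u * v) = \sum_(n < l.+1) Sq n u * Sq (l - n)%N v;
  Sq0_lambda : forall i, (i < r)%N -> Sq 0%N (two_lambda i) = two_lambda i.+1;
  Sq0_y : forall j, Sq 0%N (two_y j) = two_y j;
  Sq1_lambda : forall i, (i < r)%N -> Sq 1%N (two_lambda i) = two_lambda i ^+ 2;
  Sq1_y : forall j, Sq 1%N (two_y j) = two_y j ^+ 2;
  Sqn_lambda : forall n i, (1 < n)%N -> (i < r)%N -> Sq n (two_lambda i) = 0;
  Sqn_y : forall n j, (1 < n)%N -> Sq n (two_y j) = 0 }.

End TwoCohomology.

(** * Existence of the Steenrod operations *)

Module SteenrodExistence.

Section ExtEval.
Variables (R : comNzRingType) (n : nat) (B : nzRingType).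
Variables (phi : {rmorphism {mpoly R[n]} -> B}) (b : 'I_n -> B).
Hypothesis phi_b : forall a i, GRing.comm (phi a) (b i).
Hypothesis b_sqr : forall i, b i * b i = 0.
Hypothesis b_anti : forall i j, b i * b j = - (b j * b i).

Definition ext_prod (S : {set 'I_n}) : B := \prod_(i in S) b i.

Lemma ext_prod_seq (s : seq 'I_n) (i : 'I_n) (T : {set 'I_n}) :
  sorted (fun i j : 'I_n => (i < j)%N) s -> i \in s ->
  b i * \prod_(j <- s | j \in T) b j =
  if i \in T then 0 else
    (-1) ^+ (\sum_(j <- s | j \in T) (j < i))%N * \prod_(j <- s | j \in i |: T) b j.
Proof.
have tr : transitive (fun i j : 'I_n => (i < j)%N) by move=> x y z; apply: ltn_trans.
elim: s => // h s IH; rewrite /= path_sortedE // => /andP[/allP hs ss].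
rewrite inE => /predU1P[->|i_s].
  rewrite !big_cons in_setU1 eqxx /=; case: ifP => hT; first by rewrite mulrA b_sqr mul0r.
  rewrite [X in _ ^+ X]big_seq_cond [X in _ ^+ X]big1 ?expr0 ?mul1r; last first.
    by move=> j /andP[/hs /= ltj _]; rewrite ltnNge (ltnW ltj).
  congr (_ * _); rewrite big_seq_cond [RHS]big_seq_cond; apply: eq_bigl => j.
  rewrite in_setU1; case js: (j \in s) => //=.
  by case: eqP => // jh; move: (hs j js); rewrite jh /= ltnn.
have lthi : (h < i)%N := hs i i_s.
have nhi : (h == i) = false by apply/eqP=> hi; rewrite hi ltnn in lthi.
rewrite !big_cons in_setU1 nhi /=; case: ifP => hT; last exact: IH.
rewrite mulrA b_anti mulNr -mulrA IH // lthi.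
case: ifP => _; first by rewrite mulr0 oppr0.
by rewrite exprD expr1 mulN1r mulNr !mulrA (commr_sign (b h)).
Qed.

Lemma ext_prod1 i T : b i * ext_prod T =
  if i \in T then 0 else
    (-1) ^+ (\sum_(j in T) (j < i))%N * ext_prod (i |: T).
Proof.
apply: ext_prod_seq; last by rewrite mem_index_enum.
have -> : index_enum 'I_n = enum 'I_n by rewrite enumT [index_enum _]unlock.
rewrite -(@sorted_map _ _ val ltn); first by rewrite val_enum_ord iota_ltn_sorted.
Qed.

Lemma ext_prodM S T : ext_prod S * ext_prod T =
  if [disjoint S & T] then (-1) ^+ inversions S T * ext_prod (S :|: T) else 0.
Proof.
move: {2}#|S| (erefl #|S|) => m; elim: m S => [|m IH] S.
  move/eqP; rewrite cards_eq0 => /eqP->.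
  rewrite -setI_eq0 set0I eqxx set0U /ext_prod /inversions !big_set0.
  by rewrite expr0.
move=> cS; have [i0 i0S] : exists i, i \in S by apply/card_gt0P; rewrite cS.
case: (@arg_minnP _ i0 (mem S) val i0S) => i iS imin.
have {}iS : i \in S := iS.
pose S' := S :\ i.
have eS : S = i |: S' by rewrite setD1K.
have niS' : i \notin S' by rewrite setD11.
have pS : ext_prod S = b i * ext_prod S'.
  rewrite ext_prod1 (negPf niS') -eS big1 ?expr0 ?mul1r // => j.
  rewrite !inE => /andP[_ jS]; move: (imin j jS) => /= le_ij.
  by rewrite ltnNge le_ij.
have cS' : #|S'| = m by move: cS; rewrite (cardsD1 i) iS => -[].
rewrite pS -mulrA IH //.
have -> : [disjoint S & T] = (i \notin T) && [disjoint S' & T].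
  by rewrite eS !disjoints_subset subUset sub1set inE.
case: ifP => dT; last by rewrite mulr0 andbF.
rewrite andbT mulrA commr_sign -mulrA ext_prod1 in_setU (negPf niS') /=.
case: ifP => iT; first by rewrite mulr0.
rewrite setUA -eS mulrA -exprD; congr (_ ^+ _ * _).
rewrite eS inversionsUl; last by rewrite disjoints_subset sub1set inE.
rewrite addnC; congr (_ + _)%N.
rewrite /inversions big_set1 [LHS](eq_bigl (fun j => j \in [predU S' & T])); last first.
  by move=> j; rewrite [LHS]in_setU.
rewrite bigU //= big1 // => j; rewrite !inE => /andP[_ jS].
by move: (imin j jS) => /= le_ij; rewrite ltnNge le_ij.
Qed.

Definition ext_eval (f : extpoly R n) : B :=
  \sum_(S : {set 'I_n}) phi (f S) * ext_prod S.


Lemma ext_evalD : {morph ext_eval : f g / f + g}.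
Proof.
move=> f g; rewrite /ext_eval -big_split; apply: eq_bigr => S _.
by rewrite ffunE rmorphD mulrDl.
Qed.

Lemma ext_eval0 : ext_eval 0 = 0.
Proof. by rewrite /ext_eval big1 // => S _; rewrite ffunE rmorph0 mul0r. Qed.

Lemma ext_eval_term a S : ext_eval (ext_term a S) = phi a * ext_prod S.
Proof.
rewrite /ext_eval (bigD1 S) //= ffunE eqxx mulr1n big1 ?addr0 // => T neT.
by rewrite ffunE (negPf neT) rmorph0 mul0r.
Qed.

Lemma ext_prod_comm a S : GRing.comm (phi a) (ext_prod S).
Proof. by apply: commr_prod => i _; apply: phi_b. Qed.

Lemma ext_evalM : {morph ext_eval : f g / f * g}.
Proof.
move=> f g; elim/ext_ind: f => [|f1 f2 IH1 IH2|a S]; first by rewrite mul0r ext_eval0 mul0r.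
  by rewrite mulrDl !ext_evalD mulrDl IH1 IH2.
elim/ext_ind: g => [|g1 g2 IH1 IH2|c T]; first by rewrite mulr0 ext_eval0 mulr0.
  by rewrite mulrDr !ext_evalD mulrDr IH1 IH2.
rewrite [_ * _]ext_mul_term !ext_eval_term !rmorphM /=.
have -> : phi a * ext_prod S * (phi c * ext_prod T)
          = phi a * phi c * (ext_prod S * ext_prod T).
  by rewrite -!mulrA; congr (_ * _); rewrite !mulrA ext_prod_comm.
rewrite ext_prodM /ext_sign.
case: ifP => _; last by rewrite rmorph0 !mul0r mulr0.
by rewrite rmorphXn rmorphN1 [RHS]mulrA (commr_sign (phi a * phi c)) !mulrA.
Qed.

Lemma ext_eval1 : ext_eval 1 = 1.
Proof. by rewrite [1]/(ext_term 1 set0) ext_eval_term rmorph1 mul1r /ext_prod big_set0. Qed.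

End ExtEval.

Section ExtHomog.
Variables (R : comNzRingType) (n : nat).
Local Notation H := (extpoly R n).
Implicit Types (f g : H) (S T : {set 'I_n}).

Definition ext_cst (a : {mpoly R[n]}) : H := ext_term a set0.

Lemma ext_cst_is_additive : {morph ext_cst : a c / a - c}.
Proof. by move=> a c; apply/ffunP=> U; rewrite !ffunE mulrnBl. Qed.

Lemma ext_cstM_term a c S : ext_cst a * ext_term c S = ext_term (a * c) S.
Proof.
rewrite [_ * _]ext_mul_term set0U /ext_sign -setI_eq0 set0I eqxx.
by rewrite /inversions big_set0 expr0 mul1r.
Qed.

Lemma ext_cst_comm a f : GRing.comm (ext_cst a) f.
Proof.
rewrite /GRing.comm; elim/ext_ind: f => [|f g IHf IHg|c S].
- by rewrite mul0r mulr0.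
- by rewrite mulrDl mulrDr IHf IHg.
rewrite ext_cstM_term [RHS]ext_mul_term setU0 /ext_sign -setI_eq0 setI0 eqxx.
rewrite /inversions big1 ?expr0 ?mul1r 1?mulrC // => i _.
by rewrite big_set0.
Qed.

Lemma ext_cst_is_multiplicative : monoid_morphism ext_cst.
Proof. by split=> // a c; rewrite /ext_cst [RHS]ext_cstM_term. Qed.

HB.instance Definition _ :=
  GRing.isAdditive.Build {mpoly R[n]} H ext_cst ext_cst_is_additive.
HB.instance Definition _ :=
  GRing.isMonoidMorphism.Build {mpoly R[n]} H ext_cst ext_cst_is_multiplicative.

Lemma ext_cstC (c : R) f : ext_cst c%:MP * f = c *: f.
Proof.
elim/ext_ind: f => [|f g IHf IHg|a S].
- by rewrite mulr0 scaler0.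
- by rewrite mulrDr scalerDr IHf IHg.
rewrite ext_cstM_term; apply/ffunP=> U; rewrite !ffunE mul_mpolyC.
by rewrite scalerMnr.
Qed.

Lemma ext_homog0 d : ext_homog d (0 : H).
Proof. by move=> S m; rewrite ffunE msupp0. Qed.

Lemma ext_homogD d f g : ext_homog d f -> ext_homog d g -> ext_homog d (f + g).
Proof.
move=> hf hg S m; rewrite ffunE => /msuppD_le; rewrite mem_cat.
by case/orP=> [/hf|/hg].
Qed.

Lemma ext_homogN d f : ext_homog d f -> ext_homog d (- f).
Proof.
by move=> hf S m; rewrite ffunE (perm_mem (msuppN _)) => /hf.
Qed.

Lemma ext_homog_sum d I (s : seq I) (Q : pred I) (F : I -> H) :
  (forall i, Q i -> ext_homog d (F i)) -> ext_homog d (\sum_(i <- s | Q i) F i).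
Proof.
move=> hF; elim/big_ind: _ => //; first exact: ext_homog0.
by move=> f g; apply: ext_homogD.
Qed.

Lemma ext_homogZ d c f : ext_homog d f -> ext_homog d (c *: f).
Proof. by move=> hf S m; rewrite ffunE => /msuppZ_le /hf. Qed.

Lemma ext_homog_ind (d : nat) (K : H -> Prop) :
  K 0 -> (forall f g, K f -> K g -> K (f + g)) ->
  (forall c (m : 'X_{1..n}) S, (2 * mdeg m + #|S|)%N = d ->
     K (ext_term (c *: 'X_[m]) S)) ->
  forall f, ext_homog d f -> K f.
Proof.
move=> K0 KD Kt f hf; rewrite (ext_sum_terms f).
apply: (big_ind K) => // S _; rewrite [f S]mpolyE.
have -> : ext_term (\sum_(m <- msupp (f S)) (f S)@_m *: 'X_[m]) S =
          \sum_(m <- msupp (f S)) ext_term ((f S)@_m *: 'X_[m]) S.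
  apply/ffunP=> U; rewrite sum_ffunE !ffunE -sumrMnl.
  by apply: eq_bigr => m _; rewrite ffunE.
rewrite big_seq; apply: (big_ind K) => // m mS; apply: Kt.
exact: hf.
Qed.

Lemma ext_homog_term c (m : 'X_{1..n}) S :
  ext_homog (2 * mdeg m + #|S|) (ext_term (c *: 'X_[m]) S : H).
Proof.
move=> U m'; rewrite ffunE; case: eqP => [->|_]; last by rewrite mulr0n msupp0.
by rewrite mulr1n => /msuppZ_le; rewrite msuppX inE => /eqP->.
Qed.

Lemma ext_homogM d e f g : ext_homog d f -> ext_homog e g ->
  ext_homog (d + e) (f * g).
Proof.
move=> hf hg; elim/ext_homog_ind: hf => [|f1 f2 h1 h2|a m S <-].
- by rewrite mul0r; apply: ext_homog0.
- by rewrite mulrDl; apply: ext_homogD.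
elim/ext_homog_ind: hg => [|f1 f2 h1 h2|c m' T <-].
- by rewrite mulr0; apply: ext_homog0.
- by rewrite mulrDr; apply: ext_homogD.
rewrite [_ * _]ext_mul_term /ext_sign; case: ifP => dST; last first.
  by move=> U q; rewrite !mul0r ffunE mul0rn msupp0.
have -> : (-1) ^+ inversions S T * (a *: 'X_[m]) * (c *: 'X_[m'])
        = ((-1) ^+ inversions S T * a * c) *: 'X_[m + m'] :> {mpoly R[n]}.
  rewrite mpolyXD -!mul_mpolyC !mpolyCM rmorphXn rmorphN1 !mulrA.
  by rewrite [in LHS](mulrAC _ 'X_[m]).
have -> : (2 * mdeg m + #|S| + (2 * mdeg m' + #|T|))%N
        = (2 * mdeg (m + m') + #|S :|: T|)%N.
  by rewrite mdegD cardsU disjoint_setI0 // cards0 subn0 mulnDr addnACA.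
exact: ext_homog_term.
Qed.

End ExtHomog.

Section OddExistence.
Variables (k : fieldType) (r s p : nat).
Hypothesis hp : p \in [pchar k].
Local Notation n := (r + s)%N.
Local Notation H := (extpoly k n).
Local Notation M := ('M[H]_2).

Definition xm (i : nat) : {mpoly k[n]} :=
  if insub i is Some i' then 'X_(lshift s i') else 0.

Lemma odd_xE i : odd_x k r s i = ext_cst (xm i).
Proof. by rewrite /odd_x /xm; case: insub => // ; rewrite rmorph0. Qed.

Definition psi_gen (i : 'I_n) : {poly {mpoly k[n]}} :=
  match split i with
  | inl i' => (xm i'.+1)%:P + (xm i' ^+ p) *: 'X
  | inr j => ('X_(rshift r j))%:P + ('X_(rshift r j) ^+ p) *: 'X
  end.

Definition psi_cst : k -> {poly {mpoly k[n]}} :=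
  @polyC _ \o @mpolyC n k \o pFrobenius_aut hp.
HB.instance Definition _ := GRing.RMorphism.on psi_cst.

Definition psi : {mpoly k[n]} -> {poly {mpoly k[n]}} := mmap psi_cst psi_gen.
HB.instance Definition _ := GRing.RMorphism.on psi.

Definition scal : {mpoly k[n]} -> M := @scalar_mx H 2 \o @ext_cst k n.
HB.instance Definition _ := GRing.RMorphism.on scal.

Definition phi : {mpoly k[n]} -> {poly M} := map_poly scal \o psi.
HB.instance Definition _ := GRing.RMorphism.on phi.

Lemma phiE a : phi a = map_poly scal (psi a). Proof. by []. Qed.

Lemma psiC c : psi c%:MP = (c ^+ p)%:MP%:P.
Proof. exact: (mmapC psi_gen psi_cst). Qed.

Lemma psiX i : psi 'X_i = psi_gen i.
Proof. by rewrite [LHS](mmapX psi_gen psi_cst) mmap1U. Qed.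

(** The values of P^0 and beta P^0 on the exterior generators. *)
Definition e_img (i : 'I_n) : H :=
  match split i with inl i' => odd_lambda k r s i'.+1 | inr j => odd_y k r j end.
Definition b_img (i : 'I_n) : {mpoly k[n]} :=
  match split i with inl i' => - xm i' | inr j => 'X_(rshift r j) end.

Definition mx2 (a b c d : H) : M :=
  \matrix_(i, j) (if i == 0 then if j == 0 then a else b
                  else if j == 0 then c else d).

Lemma mx2M a b c d a' b' c' d' : mx2 a b c d * mx2 a' b' c' d' =
  mx2 (a * a' + b * c') (a * b' + b * d') (c * a' + d * c') (c * b' + d * d').
Proof.
apply/matrixP=> i j; rewrite !mxE !big_ord_recl big_ord0 !mxE /= addr0.
by case: (i == 0); case: (j == 0).
Qed.

Lemma mx2E (A : M) : A = mx2 (A 0 0) (A 0 1) (A 1 0) (A 1 1).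
Proof.
apply/matrixP=> i j; rewrite mxE.
by case: i => [[|[|i]] hi] //; case: j => [[|[|j]] hj] //=;
  congr (A _ _); apply: val_inj.
Qed.


Lemma scalE q : scal q = mx2 (ext_cst q) 0 0 (ext_cst q).
Proof.
rewrite [LHS]mx2E /scal /= !mxE /=.
by rewrite !mulr1n !mulr0n.
Qed.

Lemma scal_comm q A : GRing.comm (scal q) A.
Proof.
rewrite /GRing.comm scalE (mx2E A) !mx2M !mul0r !mulr0 !addr0 !add0r.
by congr mx2; apply: ext_cst_comm.
Qed.

Definition b_mx (i : 'I_n) : {poly M} :=
  (mx2 (- e_img i) (ext_cst (b_img i)) 0 (e_img i))%:P.

Lemma phi_comm a A : GRing.comm (phi a) A%:P.
Proof.
rewrite /GRing.comm; apply/polyP => j; rewrite coefMC coefCM coef_map.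
exact: scal_comm.
Qed.

Lemma ext_e_anti (i j : 'I_n) : ext_e k i * ext_e k j = - (ext_e k j * ext_e k i).
Proof.
rewrite [ext_e k i * _]ext_mul_term [ext_e k j * _]ext_mul_term setUC.
have tN a S : - ext_term a S = ext_term (- a) S :> H.
  by apply/ffunP=> U; rewrite !ffunE mulNrn.
rewrite tN; congr ext_term; rewrite !mulr1 /ext_sign.
rewrite !disjoints_subset !sub1set !inE [i == j]eq_sym.
case: eqP => [_|/eqP nij] /=; first by rewrite oppr0.
rewrite /inversions !big_set1.
have /orP[lt|lt] : (i < j)%N || (j < i)%N.
  by rewrite -neq_ltn; move: nij; rewrite ?[j == i]eq_sym -val_eqE.
  by rewrite lt ltnNge (ltnW lt) expr1 ?opprK.
by rewrite lt ltnNge (ltnW lt) expr1 ?opprK.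
Qed.

Lemma ext_e_sqr (i : 'I_n) : ext_e k i * ext_e k i = 0.
Proof.
rewrite [_ * _]ext_mul_term /ext_sign disjoints_subset sub1set !inE eqxx /=.
by rewrite !mul0r; apply/ffunP=> U; rewrite !ffunE mul0rn.
Qed.

Lemma e_imgP i : e_img i = 0 \/ exists i', e_img i = ext_e k i'.
Proof.
rewrite /e_img; case: split => [i'|j]; last by right; exists (rshift r j).
by rewrite /odd_lambda; case: insub => [i''|]; [right; exists (lshift s i'')|left].
Qed.

Lemma e_img_anti i j : e_img i * e_img j = - (e_img j * e_img i).
Proof.
case: (e_imgP i) => [->|[i' ->]]; first by rewrite mul0r mulr0 oppr0.
case: (e_imgP j) => [->|[j' ->]]; first by rewrite mul0r mulr0 oppr0.
exact: ext_e_anti.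
Qed.

Lemma e_img_sqr i : e_img i * e_img i = 0.
Proof. by case: (e_imgP i) => [->|[i' ->]]; rewrite ?mul0r ?ext_e_sqr. Qed.

Lemma b_mx_sqr i : b_mx i * b_mx i = 0.
Proof.
rewrite /b_mx -rmorphM /= mx2M !mulr0 !mul0r mulrNN e_img_sqr !addr0.
rewrite mulNr ext_cst_comm addNr (_ : mx2 0 0 0 0 = 0) //.
by rewrite [RHS]mx2E !mxE.
Qed.

Lemma b_mx_anti i j : b_mx i * b_mx j = - (b_mx j * b_mx i).
Proof.
rewrite /b_mx -!rmorphM -rmorphN /= !mx2M !mulr0 !mul0r !mulrNN !addr0 !add0r.
congr (_ %:P); rewrite [RHS]mx2E !mxE /= oppr0.
rewrite (e_img_anti i j) !mulNr opprD opprK !(ext_cst_comm (b_img j)).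
by rewrite -(ext_cst_comm (b_img i)) addrC -(ext_cst_comm (b_img j)).
Qed.

(** The ring morphism u |-> sum_j t^j [[(-1)^|u| P^j u, bP^j u], [0, P^j u]]; its
    multiplicativity is equivalent to the two Cartan formulas. *)
Definition total : H -> {poly M} := ext_eval phi b_mx.

Lemma total_term a S : total (ext_term a S) = phi a * ext_prod b_mx S.
Proof. exact: ext_eval_term. Qed.

Lemma totalM u v : total (u * v) = total u * total v.
Proof.
apply: ext_evalM; [by move=> a i; apply: phi_comm|exact: b_mx_sqr|exact: b_mx_anti].
Qed.

Lemma totalD u v : total (u + v) = total u + total v.
Proof. exact: ext_evalD. Qed.

Lemma total0 : total 0 = 0.
Proof. exact: ext_eval0. Qed.

Local Opaque total.

Lemma totalZ a u : total (a *: u) = (scal (a ^+ p)%:MP)%:P * total u.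
Proof.
rewrite -ext_cstC totalM; congr (_ * _).
by rewrite total_term /ext_prod big_set0 mulr1 phiE psiC map_polyC.
Qed.

Definition Pj (j : nat) (u : H) : H := (total u)`_j 1 1.
Definition bPj (j : nat) (u : H) : H := (total u)`_j 0 1.

(** The conditions satisfied by [total u] for u homogeneous of degree [d]. *)
Definition good (d : nat) (F : {poly M}) : Prop :=
  forall j, [/\ F`_j 1 0 = 0, F`_j 0 0 = (-1) ^+ d * F`_j 1 1,
    ext_homog (d + 2 * j * (p - 1))%N (F`_j 1 1)
    & ext_homog (d + 2 * j * (p - 1) + 1)%N (F`_j 0 1)].

Lemma mx2_mulE (A A' : M) : A * A' = 
  mx2 (A 0 0 * A' 0 0 + A 0 1 * A' 1 0) (A 0 0 * A' 0 1 + A 0 1 * A' 1 1)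
      (A 1 0 * A' 0 0 + A 1 1 * A' 1 0) (A 1 0 * A' 0 1 + A 1 1 * A' 1 1).
Proof. by rewrite {1}(mx2E A) {1}(mx2E A') mx2M. Qed.

Lemma coef_entryM (F G : {poly M}) j (a b : 'I_2) :
  (F * G)`_j a b = \sum_(i < j.+1) (F`_i * G`_(j - i)) a b.
Proof. by rewrite coefM summxE. Qed.

Lemma coef_entryD (F G : {poly M}) j (a b : 'I_2) :
  (F + G)`_j a b = F`_j a b + G`_j a b.
Proof. by rewrite coefD mxE. Qed.

Lemma coef_entryD0 (F G : {poly M}) j (a b : 'I_2) :
  F`_j a b = 0 -> G`_j a b = 0 -> (F + G)`_j a b = 0.
Proof. by rewrite coef_entryD => -> ->; rewrite addr0. Qed.

Lemma mul00 (A B : M) : (A * B) 0 0 = A 0 0 * B 0 0 + A 0 1 * B 1 0.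
Proof. by rewrite mx2_mulE mxE. Qed.
Lemma mul01 (A B : M) : (A * B) 0 1 = A 0 0 * B 0 1 + A 0 1 * B 1 1.
Proof. by rewrite mx2_mulE mxE. Qed.
Lemma mul10 (A B : M) : (A * B) 1 0 = A 1 0 * B 0 0 + A 1 1 * B 1 0.
Proof. by rewrite mx2_mulE mxE. Qed.
Lemma mul11 (A B : M) : (A * B) 1 1 = A 1 0 * B 0 1 + A 1 1 * B 1 1.
Proof. by rewrite mx2_mulE mxE. Qed.

Lemma scal00 q : scal q 0 0 = ext_cst q. Proof. by rewrite scalE mxE. Qed.
Lemma scal01 q : scal q 0 1 = 0. Proof. by rewrite scalE mxE. Qed.
Lemma scal10 q : scal q 1 0 = 0. Proof. by rewrite scalE mxE. Qed.
Lemma scal11 q : scal q 1 1 = ext_cst q. Proof. by rewrite scalE mxE. Qed.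

Lemma ext_homog_sgn d e (u : H) : ext_homog d u -> ext_homog d ((-1) ^+ e * u).
Proof.
by move=> hu; rewrite -signr_odd; case: odd; rewrite ?expr1 ?expr0 ?mulN1r ?mul1r //;
  apply: ext_homogN.
Qed.

Lemma goodM d e F G : good d F -> good e G -> good (d + e) (F * G).
Proof.
move=> hF hG j; rewrite !coef_entryM; split.
- rewrite big1 // => i _; rewrite mx2_mulE mxE /=.
  by case: (hF i) (hG (j - i)%N) => -> _ _ _ [-> _ _ _]; rewrite mul0r mulr0 addr0.
- rewrite mulr_sumr; apply: eq_bigr => i _; rewrite !mx2_mulE !mxE /=.
  case: (hF i) (hG (j - i)%N) => -> -> _ _ [-> -> _ _].
  rewrite mulr0 mul0r addr0 add0r exprD -!mulrA; congr (_ * _).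
  by rewrite !mulrA commr_sign.
- apply: ext_homog_sum => i _; rewrite mx2_mulE mxE /=.
  case: (hF i) (hG (j - i)%N) => -> _ h1 _ [_ _ h2 _]; rewrite mul0r add0r.
  have -> : (d + e + 2 * j * (p - 1))%N
    = ((d + 2 * i * (p - 1)) + (e + 2 * (j - i) * (p - 1)))%N.
    rewrite addnACA; congr (_ + _)%N; rewrite -mulnDl -mulnDr.
    by rewrite subnKC // -ltnS.
  exact: ext_homogM.
- apply: ext_homog_sum => i _; rewrite mx2_mulE mxE /=.
  case: (hF i) (hG (j - i)%N) => _ -> h1 h1' [_ _ h2 h2'].
  have -> : (d + e + 2 * j * (p - 1))%N
    = ((d + 2 * i * (p - 1)) + (e + 2 * (j - i) * (p - 1)))%N.
    rewrite addnACA; congr (_ + _)%N; rewrite -mulnDl -mulnDr.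
    by rewrite subnKC // -ltnS.
  apply: ext_homogD.
    by rewrite -addnA -mulrA; apply: ext_homog_sgn; apply: ext_homogM.
  by rewrite addnAC; apply: ext_homogM.
Qed.

Lemma good1 : good 0 1.
Proof.
move=> j; rewrite coefC; case: j => [|j]; rewrite !mxE /=; split=> //;
 rewrite ?mulr0 ?mulr0n ?mul1r //; try exact: ext_homog0.
by have := @ext_homog_term k n 1 0%MM set0;
  rewrite mdeg0 cards0 scale1r mpolyX0.
Qed.

Lemma goodX d m F : good d F -> good (d * m) (F ^+ m).
Proof.
move=> hF; elim: m => [|m IH]; first by rewrite muln0 expr0; apply: good1.
by rewrite mulnS exprS; apply: goodM.
Qed.

Lemma p_gt0 : (0 < p)%N.
Proof. by apply: prime_gt0; apply: pcharf_prime hp. Qed.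

Lemma good_scal d (Q : {poly {mpoly k[n]}}) : ~~ odd d ->
  (forall j, ext_homog (d + 2 * j * (p - 1))%N (ext_cst Q`_j)) ->
  good d (map_poly scal Q).
Proof.
move=> ed hQ j; rewrite coef_map /= scalE !mxE /= -signr_odd (negPf ed) mul1r.
by split=> //; apply: ext_homog0.
Qed.

Lemma homog_X i : ext_homog 2 (ext_cst ('X_i : {mpoly k[n]})).
Proof.
have := @ext_homog_term k n 1 U_(i)%MM set0.
by rewrite mdeg1 cards0 scale1r.
Qed.

Lemma homog_xm i : ext_homog 2 (ext_cst (xm i)).
Proof.
rewrite /xm; case: insub => [i'|]; first exact: homog_X.
by rewrite rmorph0; apply: ext_homog0.
Qed.

Lemma homogX d m (u : H) : ext_homog d u -> ext_homog (d * m) (u ^+ m).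
Proof.
move=> hu; elim: m => [|m IH].
  rewrite muln0 expr0; have := @ext_homog_term k n 1 0%MM set0.
  by rewrite mdeg0 cards0 scale1r mpolyX0.
by rewrite mulnS exprS; apply: ext_homogM.
Qed.

Lemma good_gen (a c : {mpoly k[n]}) :
  ext_homog 2 (ext_cst a) -> ext_homog 2 (ext_cst c) ->
  good 2 (map_poly scal (a%:P + (c ^+ p) *: 'X)).
Proof.
move=> ha hc; apply: good_scal => // j.
rewrite coefD coefC coefZ coefX; case: j => [|[|j]] /=.
- by rewrite mulr0 addr0 muln0 mul0n addn0.
- rewrite mulr1 add0r rmorphXn.
  have -> : (2 + 2 * 1 * (p - 1) = 2 * p)%N.
    by rewrite muln1 -mulnS subn1 prednK ?p_gt0.
  exact: homogX.
- by rewrite mulr0 addr0 rmorph0; apply: ext_homog0.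
Qed.

Lemma good_phiX (i : 'I_n) : good 2 (phi 'X_i).
Proof.
rewrite phiE psiX /psi_gen.
case: split => [i'|j].
  by apply: good_gen; apply: homog_xm.
by apply: good_gen; apply: homog_X.
Qed.

Lemma good_phi (m : 'X_{1..n}) : good (2 * mdeg m) (phi 'X_[m]).
Proof.
rewrite mpolyXE_id rmorph_prod /= mdegE big_distrr /=.
elim/big_ind2: _ => [|d F e G hF hG|i _]; [exact: good1|exact: goodM|].
by rewrite rmorphXn; apply: goodX; apply: good_phiX.
Qed.

Lemma good_b i : good 1 (b_mx i).
Proof.
move=> j; rewrite /b_mx coefC; case: j => [|j]; rewrite !mxE /=; last first.
  by rewrite mulr0; split=> //; apply: ext_homog0.
rewrite muln0 mul0n expr1 mulN1r; split=> //.
  case: (e_imgP i) => [->|[i' ->]]; first exact: ext_homog0.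
  by have := @ext_homog_term k n 1 0%MM [set i'];
    rewrite mdeg0 cards1 scale1r mpolyX0.
rewrite /b_img; case: split => [i'|j']; last exact: homog_X.
by rewrite rmorphN; apply: ext_homogN; apply: homog_xm.
Qed.

Lemma good_prod (S : {set 'I_n}) : good #|S| (ext_prod b_mx S).
Proof.
rewrite /ext_prod -sum1_card.
elim/big_ind2: _ => [|d F e G hF hG|i _]; [exact: good1|exact: goodM|exact: good_b].
Qed.

Lemma goodD d F G : good d F -> good d G -> good d (F + G).
Proof.
move=> hF hG j; rewrite coefD !mxE; case: (hF j) (hG j) => -> -> h1 h2 [-> -> h3 h4].
by split; rewrite ?addr0 ?mulrDr //; apply: ext_homogD.
Qed.

Lemma good0 d : good d 0.
Proof.
by move=> j; rewrite coef0 !mxE mulr0; split=> //; apply: ext_homog0.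
Qed.

Lemma good_total d u : ext_homog d u -> good d (total u).
Proof.
elim/ext_homog_ind => [|f g hf hg|c m S <-].
- by rewrite total0; apply: good0.
- by rewrite totalD; apply: goodD.
have -> : ext_term (c *: 'X_[m]) S = c *: (ext_term 'X_[m] S) :> H.
  by rewrite -ext_cstC ext_cstM_term mul_mpolyC.
rewrite totalZ -[X in good X]add0n; apply: goodM.
  rewrite -map_polyC; apply: good_scal => // j; rewrite coefC.
  case: j => [|j] /=; last by rewrite rmorph0; apply: ext_homog0.
  have := @ext_homog_term k n (c ^+ p) 0%MM set0.
  by rewrite mdeg0 cards0 mpolyX0 -mul_mpolyC mulr1.
by rewrite total_term; apply: goodM; [exact: good_phi|exact: good_prod].
Qed.

Lemma total10 u j : (total u)`_j 1 0 = 0.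
Proof.
elim/ext_ind: u => [|f g hf hg|a S].
- by rewrite total0 coef0 mxE.
- rewrite totalD; exact: coef_entryD0 hf hg.
rewrite total_term coef_entryM big1 // => i _; rewrite mul10.
rewrite coef_map scal10 mul0r add0r.
by case: (good_prod S (j - i)%N) => -> *; rewrite mulr0.
Qed.

Lemma total_xm (i : nat) : (i < r)%N ->
  total (odd_x k r s i) = map_poly scal ((xm i.+1)%:P + (xm i ^+ p) *: 'X).
Proof.
move=> lt_ir; rewrite odd_xE total_term /ext_prod big_set0 mulr1 phiE.
rewrite {1}/xm insubT psiX /psi_gen.
by rewrite -[lshift _ _]/(unsplit (inl _)) unsplitK.
Qed.

Lemma total_z j : total (odd_z k r j) = map_poly scal
  (('X_(rshift r j))%:P + ('X_(rshift r j) ^+ p) *: 'X).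
Proof.
rewrite total_term /ext_prod big_set0 mulr1 phiE psiX /psi_gen.
by rewrite -[rshift _ _]/(unsplit (inr _)) unsplitK.
Qed.

Lemma total_e i : total (ext_e k i) = b_mx i.
Proof. by rewrite total_term rmorph1 mul1r /ext_prod big_set1. Qed.

Lemma total_lambda (i : nat) : (i < r)%N -> total (odd_lambda k r s i) =
  (mx2 (- odd_lambda k r s i.+1) (- odd_x k r s i) 0 (odd_lambda k r s i.+1))%:P.
Proof.
move=> lt_ir; rewrite odd_xE {1}/odd_lambda insubT total_e /b_mx /e_img /b_img.
by rewrite -[lshift _ _]/(unsplit (inl _)) unsplitK /= rmorphN.
Qed.

Lemma total_y j : total (odd_y k r j) =
  (mx2 (- odd_y k r j) (odd_z k r j) 0 (odd_y k r j))%:P.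
Proof.
rewrite total_e /b_mx /e_img /b_img.
by rewrite -[rshift _ _]/(unsplit (inr _)) unsplitK.
Qed.

Lemma Pj_bPj_steenrod : steenrod_odd p Pj bPj.
Proof.
have coefg (a c : {mpoly k[n]}) j : (map_poly scal (a%:P + c *: 'X))`_j =
  scal (if j is j'.+1 then if j' is 0 then c else 0 else a).
  rewrite coef_map coefD coefC coefZ coefX /=; congr scal.
  by case: j => [|[|j]]; rewrite /= ?mulr0 ?mulr1 ?addr0 ?add0r.
split; rewrite /Pj /bPj.
- move=> j; split=> [u v|a u]; first by rewrite totalD coef_entryD.
  by rewrite totalZ coefCM mul11 scal10 scal11 mul0r add0r ext_cstC.
- move=> j; split=> [u v|a u]; first by rewrite totalD coef_entryD.
  by rewrite totalZ coefCM mul01 scal00 scal01 mul0r addr0 ext_cstC.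
- by move=> j d u /good_total/(_ j)[].
- by move=> j d u /good_total/(_ j)[].
- move=> l u v; rewrite totalM coef_entryM; apply: eq_bigr => i _.
  by rewrite mul11 total10 mul0r add0r.
- move=> l d u v hu; rewrite totalM coef_entryM; apply: eq_bigr => i _.
  rewrite mul01 addrC; case: (good_total hu i) => _ -> _ _.
  by rewrite mulrA.
- by move=> i hi; rewrite total_xm // coefg scalE mxE /= odd_xE.
- by move=> i hi; rewrite total_lambda // coefC mxE.
- by move=> j; rewrite total_z coefg scalE mxE.
- by move=> j; rewrite total_y coefC mxE.
- by move=> i hi; rewrite total_xm // coefg scalE mxE /= rmorphXn odd_xE.
- by move=> j; rewrite total_z coefg scalE mxE /= rmorphXn.
- by move=> [|[|m]] i // _ hi; rewrite total_xm // coefg scalE mxE /= rmorph0.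
- by move=> [|[|m]] j // _; rewrite total_z coefg scalE mxE /= rmorph0.
- by move=> [|m] i // _ hi; rewrite total_lambda // coefC mxE.
- by move=> [|m] j // _; rewrite total_y coefC mxE.
- by move=> i hi; rewrite total_lambda // coefC mxE.
- by move=> j; rewrite total_y coefC mxE.
- by move=> i hi; rewrite total_xm // coefg scalE mxE.
- by move=> j; rewrite total_z coefg scalE mxE.
- by move=> m i _ hi; rewrite total_xm // coefg scalE mxE.
- by move=> m j _; rewrite total_z coefg scalE mxE.
- by move=> [|m] i // _ hi; rewrite total_lambda // coefC mxE.
- by move=> [|m] j // _; rewrite total_y coefC mxE.
Qed.

Theorem steenrod_odd_exists :
  exists P bP : nat -> Hodd k r s -> Hodd k r s, steenrod_odd p P bP.
Proof. by exists Pj, bPj; apply: Pj_bPj_steenrod. Qed.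

End OddExistence.

Section TwoExistence.
Variables (k : fieldType) (r s : nat).
Hypothesis hp : 2%N \in [pchar k].
Local Notation n := (r + s)%N.
Local Notation H := {mpoly k[n]}.

Definition tpsi_gen (i : 'I_n) : {poly H} :=
  match split i with
  | inl i' => (two_lambda k r s i'.+1)%:P + (two_lambda k r s i' ^+ 2) *: 'X
  | inr j => (two_y k r j)%:P + (two_y k r j ^+ 2) *: 'X
  end.

Definition tpsi_cst : k -> {poly H} :=
  @polyC _ \o @mpolyC n k \o pFrobenius_aut hp.
HB.instance Definition _ := GRing.RMorphism.on tpsi_cst.

Definition tpsi : H -> {poly H} := mmap tpsi_cst tpsi_gen.
HB.instance Definition _ := GRing.RMorphism.on tpsi.

Definition Sqj (j : nat) (u : H) : H := (tpsi u)`_j.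

Lemma tpsiC c : tpsi c%:MP = (c ^+ 2)%:MP%:P.
Proof. exact: (mmapC tpsi_gen tpsi_cst). Qed.

Lemma tpsiX i : tpsi 'X_i = tpsi_gen i.
Proof. by rewrite [LHS](mmapX tpsi_gen tpsi_cst) mmap1U. Qed.

Lemma tpsiM : {morph tpsi : u v / u * v}.
Proof. exact: rmorphM. Qed.

Lemma tpsiD : {morph tpsi : u v / u + v}.
Proof. exact: rmorphD. Qed.

Definition tgood (d : nat) (F : {poly H}) : Prop :=
  forall j, F`_j \is (d + j).-homog.

Lemma tgoodM d e F G : tgood d F -> tgood e G -> tgood (d + e) (F * G).
Proof.
move=> hF hG j; rewrite coefM; apply: rpred_sum => i _.
have -> : (d + e + j = (d + i) + (e + (j - i)))%N.
  by rewrite addnACA subnKC // -ltnS.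
exact: dhomogM.
Qed.

Lemma tgood1 : tgood 0 1.
Proof.
by move=> j; rewrite coefC; case: j => [|j] /=; rewrite ?dhomog1 ?dhomog0.
Qed.

Lemma two_lambda_homog i : two_lambda k r s i \is 1.-homog.
Proof.
rewrite /two_lambda; case: insub => [i'|]; last exact: dhomog0.
by rewrite dhomogX /= mdeg1.
Qed.

Lemma two_y_homog (j : 'I_s) : two_y k r j \is 1.-homog.
Proof. by rewrite dhomogX /= mdeg1. Qed.

Lemma tgood_gen (a c : H) : a \is 1.-homog -> c \is 1.-homog ->
  tgood 1 (a%:P + (c ^+ 2) *: 'X).
Proof.
move=> ha hc j; rewrite coefD coefC coefZ coefX; case: j => [|[|j]] /=.
- by rewrite mulr0 addr0.
- by rewrite mulr1 add0r expr2; apply: (dhomogM hc hc).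
- by rewrite mulr0 addr0 dhomog0.
Qed.

Lemma tgoodX (i : 'I_n) : tgood 1 (tpsi 'X_i).
Proof.
rewrite tpsiX /tpsi_gen; case: split => [i'|j]; apply: tgood_gen;
  by [exact: two_lambda_homog|exact: two_y_homog].
Qed.

Lemma tgood_mon (m : 'X_{1..n}) : tgood (mdeg m) (tpsi 'X_[m]).
Proof.
rewrite mpolyXE_id rmorph_prod /= mdegE.
elim/big_ind2: _ => [|d F e G hF hG|i _]; [exact: tgood1|exact: tgoodM|].
rewrite rmorphXn /=; elim: (m i) => [|a IH]; first by rewrite expr0; apply: tgood1.
by rewrite exprS -add1n; apply: tgoodM => //; apply: tgoodX.
Qed.

Lemma tgood_tpsi d u : u \is d.-homog -> tgood d (tpsi u).
Proof.
move=> hu; rewrite [u]mpolyE big_seq.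
apply: (big_ind (fun v => tgood d (tpsi v))) => [j|v w hv hw j|m mu j].
- by rewrite (_ : tpsi 0 = 0) ?coef0 ?dhomog0 //; apply: (raddf0 tpsi).
- by rewrite tpsiD coefD; apply: rpredD; [exact: hv|exact: hw].
rewrite -mul_mpolyC tpsiM tpsiC coefCM mul_mpolyC; apply: rpredZ.
rewrite -(dhomog_mf hu mu); exact: tgood_mon.
Qed.

Lemma Sqj_steenrod : steenrod_two Sqj.
Proof.
have E (a c : H) j : (a%:P + c *: 'X)`_j =
  (if j is j'.+1 then if j' is 0 then c else 0 else a).
  rewrite coefD coefC coefZ coefX /=.
  by case: j => [|[|j]]; rewrite /= ?mulr0 ?mulr1 ?addr0 ?add0r.
have L i : (i < r)%N -> tpsi (two_lambda k r s i) =
    (two_lambda k r s i.+1)%:P + (two_lambda k r s i ^+ 2) *: 'X.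
  move=> hi; rewrite {1}/two_lambda insubT tpsiX /tpsi_gen.
  by rewrite -[lshift _ _]/(unsplit (inl _)) unsplitK.
have Y (j : 'I_s) : tpsi (two_y k r j) = (two_y k r j)%:P + (two_y k r j ^+ 2) *: 'X.
  by rewrite tpsiX /tpsi_gen -[rshift _ _]/(unsplit (inr _)) unsplitK.
split; rewrite /Sqj.
- move=> j; split=> [u v|a u]; first by rewrite tpsiD coefD.
  by rewrite -mul_mpolyC tpsiM tpsiC coefCM mul_mpolyC.
- by move=> j d u /tgood_tpsi/(_ j).
- by move=> l u v; rewrite tpsiM coefM.
- by move=> i hi; rewrite L // E.
- by move=> j; rewrite Y E.
- by move=> i hi; rewrite L // E.
- by move=> j; rewrite Y E.
- by move=> [|[|m]] i // _ hi; rewrite L // E.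
- by move=> [|[|m]] j // _; rewrite Y E.
Qed.

Theorem steenrod_two_exists :
  exists Sq : nat -> Htwo k r s -> Htwo k r s, steenrod_two Sq.
Proof. by exists Sqj; apply: Sqj_steenrod. Qed.

End TwoExistence.

End SteenrodExistence.

(* Main.v *)
(* Write X_a for the polynomial generators x_i, z_j, and e_a for the corresponding
   lambda_i, y_j. The operation beta P^1 beta P^0 (Sq^3 Sq^1 if p = 2) kills the linear
   forms in the X_a and carries e_a e_b, up to sign, to X_a^p P^0(X_b) - P^0(X_a) X_b^p.
   A degree two element of I therefore yields in I either a non-zero linear form in the
   X_a or a non-zero combination of these twisted minors, whose coefficients are p-th
   powers.

   P^0 shifts the x_i and fixes the z_j, so iterating it on a linear form leaves either
   a non-zero form in the z_j or a multiple of x_r. If no minor in the z_j alone occurs,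
   iterating P^0 just short of annihilation turns the combination of minors into x_r^p
   times a non-zero linear form, and P^j with j = p^m moves x_r^(p^m) to x_r^(p^(m+1))
   while applying P^0 to the linear factor.

   Otherwise P^0 iterated r times leaves sum_b L_b^p z_b with linear forms L_b in the
   z_j, and the P^(p^m) give sum_b L_b^(p^m) z_b in I for all m >= 1. After a reduction
   to F_p-linearly independent L_b, eliminating unknowns from this system shows that
   some z-linear form times a Moore determinant in the L_b lies in I, and a Moore
   determinant is a product of linear forms. *)
From HB Require Import structures.
Require Import Defs.
From mathcomp Require Import all_boot all_order all_algebra.
From mathcomp Require Import mpoly zify.
From Stdlib Require Import Classical.

Set Implicit Arguments.
Unset Strict Implicit.
Unset Printing Implicit Defensive.

Import GRing.Theory.
Local Open Scope ring_scope.

(** * Moore elimination *)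

Section FrobeniusPowers.
Variables (R : comNzRingType) (p : nat).
Hypothesis pR : p \in [pchar R].

Lemma pnat_pchar_exp m : [pchar R].-nat (p ^ m)%N.
Proof. by rewrite pnatX pnatE ?(pcharf_prime pR) // pR. Qed.

Lemma pexprD m (x y : R) : (x + y) ^+ (p ^ m) = x ^+ (p ^ m) + y ^+ (p ^ m).
Proof. exact/exprDn_pchar/pnat_pchar_exp. Qed.

Lemma pexprN m (x : R) : (- x) ^+ (p ^ m) = - x ^+ (p ^ m).
Proof.
apply/eqP; rewrite -addr_eq0 -pexprD addNr expr0n.
by rewrite expn_eq0 -leqn0 leqNgt prime_gt0 // (pcharf_prime pR).
Qed.

Lemma pexprB m (x y : R) : (x - y) ^+ (p ^ m) = x ^+ (p ^ m) - y ^+ (p ^ m).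
Proof. by rewrite pexprD pexprN. Qed.

Lemma pexprMn m (x : R) e : (x *+ e) ^+ (p ^ m) = x ^+ (p ^ m) *+ e.
Proof.
elim: e => [|e IH]; last by rewrite !mulrS pexprD IH.
by rewrite !mulr0n expr0n expn_eq0 -leqn0 leqNgt prime_gt0 // (pcharf_prime pR).
Qed.

Lemma pexpr_sum m I (s : seq I) (Q : pred I) (F : I -> R) :
  (\sum_(i <- s | Q i) F i) ^+ (p ^ m) = \sum_(i <- s | Q i) F i ^+ (p ^ m).
Proof.
elim/big_rec2: _ => [|i x y _ <-]; last by rewrite pexprD.
by rewrite -(mulr0n 0) pexprMn mulr0n.
Qed.

End FrobeniusPowers.

(** As polynomials in [x] both sides are monic of degree [p], and the multiples of [y] by elements
    of the prime field are roots of both, since e^p = e there. These roots are distinct only for [y]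
    non-zero, so [y = 0] is treated apart. *)
Lemma prod_sub_multiples (R : idomainType) (p : nat) (x y : R) :
  p \in [pchar R] ->
  \prod_(e < p) (x - y *+ e) = x ^+ p - y ^+ p.-1 * x.
Proof.
move=> pR; have p_pr := pcharf_prime pR; have p_gt0 := prime_gt0 p_pr.
have [->|y0] := eqVneq y 0.
  rewrite (eq_bigr (fun=> x)); last by move=> e _; rewrite mul0rn subr0.
  by rewrite prodr_const card_ord expr0n -subn1 subn_eq0 leqNgt prime_gt1 ?mul0r ?subr0.
pose P : {poly R} := 'X^p - (y ^+ p.-1) *: 'X.
pose rs := [seq y *+ (e : nat) | e : 'I_p].
have szX : (size (- ((y ^+ p.-1) *: 'X) : {poly R}) < size ('X^p : {poly R}))%N.
  rewrite size_polyN size_polyXn (leq_ltn_trans (size_scale_leq _ _)) //.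
  by rewrite size_polyX ltnS prime_gt1.
have szP : size P = (size rs).+1.
  by rewrite size_polyDl // size_polyXn size_map size_enum_ord.
have lP : lead_coef P = 1 by rewrite lead_coefDl // lead_coefXn.
have rP : all (root P) rs.
  apply/allP=> z /mapP[e _ ->].
  rewrite rootE !hornerE /= -mulr_natr exprMn -{1}(prednK p_gt0) exprSr.
  by rewrite -!(pFrobenius_autE pR) pFrobenius_aut_nat mulrA subrr.
have uP : uniq rs.
  rewrite map_inj_uniq ?enum_uniq // => e f /eqP; rewrite -subr_eq0.
  wlog le : e f / (f <= e)%N.
    move=> h; have [/h //|/ltnW/h {}h] := leqP f e.
    by rewrite -opprB oppr_eq0 => /h.
  rewrite -mulrnBr // -mulr_natr mulf_eq0 (negPf y0) /= -(dvdn_pcharf pR).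
  move=> dv; apply: val_inj; apply/eqP; rewrite eqn_leq le andbT -subn_eq0.
  apply: contraLR dv; rewrite -lt0n => d0; rewrite gtnNdvd //.
  exact: leq_ltn_trans (leq_subr _ _) (ltn_ord e).
pose Q : {poly R} := \prod_(z <- rs) ('X - z%:P).
have szQ : size Q = (size rs).+1 by rewrite size_prod_XsubC.
(* The leading terms cancel, so the difference has degree less than [p], yet it vanishes at [p]
   points. *)
have PQ : P - Q = 0.
  apply: (roots_geq_poly_eq0 (rs := rs)) => //.
    apply/allP=> z zrs; rewrite rootE hornerD hornerN subr_eq0.
    by rewrite (eqP (allP rP z zrs)) eq_sym -rootE root_prod_XsubC.
  rewrite -ltnS -szP ltn_neqAle; apply/andP; split; last first.
    by rewrite (leq_trans (size_polyD _ _)) // size_polyN szQ szP maxnn.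
  apply/eqP=> szD; have : lead_coef (P - Q) = 0.
    rewrite lead_coefE szD coefB -lead_coefE lP szP -szQ -lead_coefE.
    by rewrite (eqP (monic_prod_XsubC _ _ _)) subrr.
  by move/eqP; rewrite lead_coef_eq0 -size_poly_eq0 szD szP.
have /(congr1 (horner^~ x)) : P = Q by apply/eqP; rewrite -subr_eq0 PQ.
rewrite !hornerE => ->; rewrite /Q big_map horner_prod.
by rewrite big_enum /=; apply: eq_bigr => e _; rewrite !hornerE.
Qed.

Section Elimination.
Variables (R : idomainType) (p : nat) (V : zmodType).
Hypothesis pR : p \in [pchar R].
Hypothesis pV : forall v : V, v *+ p = 0.
(** [J] plays the ideal and [S] the set of products of non-zero linear forms; the aim is a common
    element. *)
Variables (J S : R -> Prop).
Hypothesis JD : forall x y, J x -> J y -> J (x + y).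
Hypothesis JM : forall a x, J x -> J (a * x).
Hypothesis S1 : S 1.
Hypothesis SM : forall x y, S x -> S y -> S (x * y).

Let p_gt0 : (0 < p)%N.
Proof. exact/prime_gt0/(pcharf_prime pR). Qed.

Lemma mul_closedX x m : S x -> S (x ^+ m).
Proof. by move=> Sx; elim: m => // m IH; rewrite exprS; apply: SM. Qed.

(* Elimination in the system of equations with unknowns w and Moore matrix
   G (L b) ^+ (p ^ k.+1); replacing G by v |-> G v ^+ p - G l ^+ p.-1 * G v, where l is
   the last of the L b, kills the last unknown and enlarges the exceptional
   subgroup U by the multiples of l. *)
Lemma moore_elimination n (G : {additive V -> R}) (U : V -> Prop)
    (L : 'I_n.+1 -> V) (w : 'I_n.+1 -> R) :
  (forall v, ~ U v -> S (G v)) ->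
  (forall e : 'I_n.+1 -> nat, U (\sum_b L b *+ e b) -> forall b, (p %| e b)%N) ->
  S (w ord0) ->
  (forall k, J (\sum_b G (L b) ^+ (p ^ k.+1) * w b)) ->
  exists2 f, S f & J f.
Proof.
elim: n => [|n IH] in G U L w *.
  move=> SG indep Sw /(_ 0%N); rewrite big_ord1.
  exists (G (L ord0) ^+ (p ^ 1) * w ord0) => //; apply: SM => //.
  apply/mul_closedX/SG => U0; have /(_ _ ord0) := indep (fun=> 1%N).
  rewrite big_ord1 mulr1n => /(_ U0).
  by rewrite gtnNdvd ?prime_gt1 // (pcharf_prime pR).
move=> SG indep Sw JG; pose l := L ord_max.
pose G'f v := G v ^+ p - G l ^+ p.-1 * G v.
have G'_add : {morph G'f : u v / u - v}.
  move=> u v; have := pexprB pR 1 (G u) (G v); rewrite /G'f expn1 raddfB mulrBr => ->.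
  by rewrite !opprB addrACA [RHS]addrACA; congr (_ + _); rewrite addrC.
pose G'm := GRing.isAdditive.Build V R G'f G'_add.
pose G' : {additive V -> R} := HB.pack G'f G'm.
have G'E v : G' v = \prod_(e < p) G (v - l *+ e).
  rewrite -[LHS]/(G'f v) /G'f -(prod_sub_multiples _ _ pR); apply: eq_bigr => e _.
  by rewrite raddfB (raddfMn G).
(* By the product formula, [G' v] lies in [S] unless some [v - l *+ e] lies in [U]. *)
pose U' v := exists e : nat, U (v - l *+ e).
apply: (IH G' U' (fun b => L (widen_ord (leqnSn _) b))
                 (fun b => w (widen_ord (leqnSn _) b))).
- move=> v nU; rewrite G'E; elim/big_ind: _ => // e _.
  by apply: SG => Ue; apply: nU; exists (e : nat).
- move=> e [f Uf] b.
  (* Coefficients are natural numbers, so [- f] is written [p.-1 * f], which acts in the same way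
     because [p] kills [V]. *)
  pose e' (c : 'I_n.+2) := if insub (c : nat) is Some c' then e c' else (p.-1 * f)%N.
  have e'w c : e' (widen_ord (leqnSn _) c) = e c by rewrite /e' valK.
  rewrite -e'w; apply: indep; rewrite big_ord_recr /=.
  under eq_bigr do rewrite e'w.
  have -> : e' ord_max = (p.-1 * f)%N by rewrite /e' insubN //= ltnn.
  rewrite -/l (_ : l *+ (p.-1 * f) = - (l *+ f)) //.
  apply/eqP; rewrite -addr_eq0 -mulrnDr -{2}(mul1n f) -mulnDl addn1 prednK //.
  by rewrite mulrnA pV mul0rn.
- by rewrite (_ : widen_ord _ _ = ord0) //; apply: val_inj.
move=> k.
(* Row [k] of the new system is row [k.+1] of the old one minus a multiple of row [k], hence again
   in [J]. *)
have G'p v : G' v ^+ (p ^ k.+1)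
    = G v ^+ (p ^ k.+2) - G l ^+ (p.-1 * p ^ k.+1) * G v ^+ (p ^ k.+1).
  by rewrite -[G' v]/(G'f v) /G'f pexprB // exprMn -!exprM -expnS.
set F := \sum_(_ < _) _.
suff -> : F = \sum_b G (L b) ^+ (p ^ k.+2) * w b
    + (- G l ^+ (p.-1 * p ^ k.+1)) * \sum_b G (L b) ^+ (p ^ k.+1) * w b.
  by apply: JD; [exact: JG|apply/JM/JG].
rewrite mulr_sumr -big_split /=.
rewrite (eq_bigr (fun b => G' (L b) ^+ (p ^ k.+1) * w b)); last first.
  by move=> b _; rewrite G'p mulrBl mulrA mulNr mulNr.
(* The last unknown drops out because [G' l = 0]. *)
rewrite big_ord_recr [X in _ = _ + X](_ : _ = 0) ?addr0 //.
have -> : G' (L ord_max) = 0 by rewrite -[LHS]/(G'f l) /G'f -exprSr prednK // subrr.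
by rewrite expr0n expn_eq0 (gtn_eqF p_gt0) mul0r.
Qed.

(** The coefficient [e b0] is invertible modulo [p], so [L b0] is a combination of the other [L b]
    over the prime field. Both [G] and the p^k-th power respect such combinations, and the term of
    [b0] spreads over the others with the same weights for all [k]. *)
Lemma relation_reduction n (G : {additive V -> R}) (L w : 'I_n.+1 -> V)
    (e : 'I_n.+1 -> nat) (b0 : 'I_n.+1) :
  \sum_b L b *+ e b = 0 -> ~~ (p %| e b0)%N ->
  exists L' w' : 'I_n -> V, forall k,
    \sum_b G (L b) ^+ (p ^ k) * G (w b) = \sum_b G (L' b) ^+ (p ^ k) * G (w' b).
Proof.
move=> sum0 ndvd; have e_gt0 : (0 < e b0)%N by case: (e b0) ndvd; rewrite ?dvdn0.
case: (egcdnP p e_gt0) => km kn Ekm _.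
have {}Ekm : (km * e b0 = kn * p + 1)%N.
  rewrite Ekm gcdnC; congr addn; apply/eqP.
  by rewrite -/(coprime _ _) prime_coprime // (pcharf_prime pR).
(* By Bezout [km] is an inverse of [e b0] modulo [p]; [f b] represents [- km * e b]. *)
pose f b := (p.-1 * (km * e b))%N.
have Lb0 : L b0 = \sum_(b < n) L (lift b0 b) *+ f (lift b0 b).
  have : \sum_b L b *+ (km * e b) = 0.
    by under eq_bigr do rewrite mulnC mulrnA; rewrite sumrMnl sum0 mul0rn.
  rewrite (bigD1_ord b0) //= Ekm mulrnDr mulr1n mulnC mulrnA pV mul0rn add0r => /eqP.
  rewrite addr_eq0 => /eqP ->; rewrite -sumrN; apply: eq_bigr => b _.
  apply/eqP; rewrite eq_sym -addr_eq0 addrC -mulrnDr -mulSn prednK //.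
  by rewrite mulrnA pV mul0rn.
exists (fun b => L (lift b0 b)), (fun b => w (lift b0 b) + w b0 *+ f (lift b0 b)).
move=> k; rewrite (bigD1_ord b0) //= {1}Lb0 raddf_sum pexpr_sum // mulr_suml.
rewrite -big_split; apply: eq_bigr => b _ /=.
by rewrite raddfD !(raddfMn G) mulrDr pexprMn // mulrnAl mulrnAr addrC.
Qed.

(** A vanishing first [w] or a relation among the [L b] shortens the system; otherwise elimination
    applies with [U] reduced to zero. Both ways of shortening preserve the sum with exponent [p],
    which is non-zero, so the system never becomes empty. *)
Lemma moore_relation n (G : {additive V -> R}) (L w : 'I_n -> V) :
  (forall v, v != 0 -> S (G v)) ->
  (forall k, J (\sum_b G (L b) ^+ (p ^ k.+1) * G (w b))) ->
  \sum_b G (L b) ^+ p * G (w b) != 0 ->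
  exists2 f, S f & J f.
Proof.
move=> SG; elim: n => [|n IH] in L w *; first by rewrite big_ord0 eqxx.
move=> JG ne0; have [w0|w0] := eqVneq (w ord0) 0.
  apply: (IH (L \o lift ord0) (w \o lift ord0)) => [k|].
    by have := JG k; rewrite big_ord_recl w0 raddf0 mulr0 add0r.
  by move: ne0; rewrite big_ord_recl w0 raddf0 mulr0 add0r.
have [|/not_all_ex_not[e /not_all_ex_not]] := classic (forall e : 'I_n.+1 -> nat,
    \sum_b L b *+ e b = 0 -> forall b, (p %| e b)%N).
  move=> indep; apply: (@moore_elimination n G (fun v => v = 0) L (G \o w)) => //=.
    by move=> v /eqP /SG.
  exact: SG.
case=> sum0 /not_all_ex_not[b0 /negP ndvd].
have [L' [w' E]] := relation_reduction G w sum0 ndvd.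
apply: (IH L' w') => [k|]; first by rewrite -E.
by have := E 1%N; rewrite expn1 => <-.
Qed.

End Elimination.

(** * The polynomial part of the cohomology *)

Notation xm := SteenrodExistence.xm.

Section LinearForms.
Variables (k : fieldType) (n : nat).
Local Notation T := {mpoly k[n]}.

(** Extended by zero to all indices, so that shifted indices need no bound. *)
Definition var (i : nat) : T := if insub i is Some a then 'X_a else 0.

Lemma var_ord (a : 'I_n) : var a = 'X_a.
Proof. by rewrite /var valK. Qed.

Lemma mcoeff_var (i : nat) (a : 'I_n) : (var i)@_U_(a) = (i == a)%:R.
Proof.
rewrite /var; case: insubP => [b _ <-|]; first by rewrite mcoeffXU.
by rewrite mcoeff0; case: eqP => // -> /negP[].
Qed.

Definition linear_form (f : T) : Prop := exists v : 'I_n -> k, f = \sum_a v a *: 'X_a.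

Lemma linear_form0 : linear_form 0.
Proof. by exists (fun=> 0); rewrite big1 // => a _; rewrite scale0r. Qed.

Lemma linear_formD f g : linear_form f -> linear_form g -> linear_form (f + g).
Proof.
move=> [v ->] [w ->]; exists (fun a => v a + w a).
by rewrite -big_split; apply: eq_bigr => a _; rewrite scalerDl.
Qed.

Lemma linear_formZ c f : linear_form f -> linear_form (c *: f).
Proof.
move=> [v ->]; exists (fun a => c * v a).
by rewrite scaler_sumr; apply: eq_bigr => a _; rewrite scalerA.
Qed.

Lemma linear_form_var i : linear_form (var i).
Proof.
rewrite /var; case: insubP => [a _ _|_]; last exact: linear_form0.
exists (fun b => (b == a)%:R); rewrite (bigD1 a) //= eqxx scale1r big1 ?addr0 //.
by move=> b /negPf->; rewrite scale0r.
Qed.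

End LinearForms.

(** * The total power operation and the iterates of P^0 *)

Section TotalPower.
Variables (k : fieldType) (p : nat).
Hypothesis hp : p \in [pchar k].
Variables (r s q : nat).
Local Notation n := (r + s)%N.
Local Notation T := {mpoly k[n]}.

Let p_gt0 : (0 < p)%N.
Proof. exact/prime_gt0/(pcharf_prime hp). Qed.

Lemma pchar_mpoly : p \in [pchar T].
Proof. exact: (rmorph_pchar (@mpolyC n k)). Qed.

Lemma xmE i : xm k r s i = if (i < r)%N then var k n i else 0.
Proof.
rewrite /xm; case: insubP => [a _ <-|/negPf-> //].
by rewrite ltn_ord -(var_ord k (lshift s a)).
Qed.

(* The N-fold iterate of the shift x_i |-> x_(i+1), z_j |-> z_j, applied to the
   a-th variable. *)
Definition shift_var (N : nat) (a : 'I_n) : T :=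
  if (a < r)%N then xm k r s (a + N) else 'X_a.

Lemma shift_var0 a : shift_var 0 a = 'X_a.
Proof. by rewrite /shift_var addn0 xmE var_ord; case: (a < r)%N. Qed.

Definition total_cst : k -> {poly T} := @polyC _ \o @mpolyC n k \o pFrobenius_aut hp.
HB.instance Definition _ := GRing.RMorphism.on total_cst.

Definition total_gen (a : 'I_n) : {poly T} :=
  (shift_var 1 a)%:P + ('X_a ^+ p) *: 'X^q.

(* For q = 1 this is f |-> sum_j t^j P^j f on the polynomial part, p odd; for p = 2,
   in terms of the squares of the generators, it is f |-> sum_j t^j Sq^j f with q = 2. *)
Definition total : T -> {poly T} := mmap total_cst total_gen.
HB.instance Definition _ := GRing.RMorphism.on total.

Lemma totalC c : total c%:MP = (c ^+ p)%:MP%:P.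
Proof. exact: (mmapC total_gen total_cst). Qed.

Lemma totalX a : total 'X_a = total_gen a.
Proof. by rewrite [LHS](mmapX total_gen total_cst) mmap1U. Qed.

Lemma totalZ c f : total (c *: f) = (c ^+ p)%:MP *: total f.
Proof. by rewrite -mul_mpolyC rmorphM /= totalC mul_polyC. Qed.

Lemma total_xm i : total (xm k r s i) =
  (xm k r s i.+1)%:P + (xm k r s i ^+ p) *: 'X^q.
Proof.
have [lt_ir|le_ri] := ltnP i r; last first.
  rewrite !xmE ltnNge le_ri /= ltnNge (leq_trans le_ri) //= rmorph0.
  by rewrite expr0n (gtn_eqF p_gt0) scale0r addr0 rmorph0.
have E : xm k r s i = 'X_(lshift s (Ordinal lt_ir)).
  by rewrite xmE lt_ir -var_ord.
by rewrite E totalX /total_gen /shift_var /= lt_ir addn1.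
Qed.

Definition P0 : T -> T := coefp 0 \o total.
HB.instance Definition _ := GRing.RMorphism.on P0.

Hypothesis q_gt0 : (0 < q)%N.

Lemma coef0_total_gen (a b : T) : (a%:P + b *: 'X^q)`_0 = a.
Proof. by rewrite coefD coefC coefZ coefXn (ltn_eqF q_gt0) mulr0 addr0. Qed.

Lemma P0Z c f : P0 (c *: f) = c ^+ p *: P0 f.
Proof. by rewrite /P0 /= totalZ coefZ mul_mpolyC. Qed.

Lemma P0_shift_var N a : P0 (shift_var N a) = shift_var N.+1 a.
Proof.
rewrite /P0 /= /shift_var; case: ifP => lt_ar.
  by rewrite total_xm coef0_total_gen addnS.
by rewrite totalX /total_gen coef0_total_gen /shift_var lt_ar.
Qed.

Lemma iter_P0Z N c f : iter N P0 (c *: f) = c ^+ (p ^ N) *: iter N P0 f.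
Proof. by elim: N => //= N ->; rewrite P0Z -exprM -expnSr. Qed.

Lemma iter_P0_var N a : iter N P0 'X_a = shift_var N a.
Proof. by elim: N => [|N /= ->]; rewrite ?shift_var0 // P0_shift_var. Qed.

Lemma iter_P0_sum N I (t : seq I) (Q : pred I) (F : I -> T) :
  iter N P0 (\sum_(i <- t | Q i) F i) = \sum_(i <- t | Q i) iter N P0 (F i).
Proof. by elim: N => //= N ->; rewrite rmorph_sum. Qed.

Variable J : T -> Prop.
Hypothesis JD : forall x y, J x -> J y -> J (x + y).
Hypothesis JM : forall a x, J x -> J (a * x).
Hypothesis J_total : forall f, J f -> forall j, J (total f)`_j.

Lemma closed_iter_P0 N f : J f -> J (iter N P0 f).
Proof. by move=> Jf; elim: N => //= N /J_total/(_ 0%N). Qed.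

(* x_r in the paper's numbering, which starts at 1. *)
Definition last_x : T := if r is r'.+1 then xm k r s r' else 1.

Lemma last_xX m :
  (if r is r'.+1 then xm k r s r' ^+ m else 1) = last_x ^+ m.
Proof.
(* As [r] occurs in the types, the match is first generalised to an arbitrary [c]. *)
suff E (x : nat -> T) c : (if c is c'.+1 then x c' ^+ m else 1)
    = (if c is c'.+1 then x c' else 1) ^+ m by exact: E.
by case: c => //; rewrite expr1n.
Qed.

Lemma last_xE : (0 < r)%N -> last_x = xm k r s r.-1.
Proof.
suff E (x : nat -> T) c : (0 < c)%N -> (if c is c'.+1 then x c' else 1) = x c.-1.
  exact: E.
by case: c.
Qed.

(** The shift kills x_r, so its total power has a single term; for r = 0 the element is 1 and [d] is
    0. *)
Lemma total_last_x : exists d, total last_x = (last_x ^+ p) *: 'X^d.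
Proof.
have [r0|r_gt0] := posnP r.
  exists 0%N; have -> : last_x = 1.
    suff E (x : nat -> T) c : c = 0%N -> (if c is c'.+1 then x c' else 1) = 1.
      exact: E.
    by move=> ->.
  by rewrite rmorph1 expr1n scale1r.
exists q; rewrite last_xE // total_xm prednK // [xm _ _ _ r]xmE ltnn.
by rewrite rmorph0 add0r.
Qed.

(** The total power of x_r^m is a monomial of degree [d * m] in the formal variable, so the
    coefficient of that degree in the product only sees the constant term of [total f]. *)
Lemma closed_last_x m f : J (last_x ^+ m * f) -> J (last_x ^+ (p * m) * P0 f).
Proof.
have [d E] := total_last_x; move/J_total/(_ (d * m)%N).
rewrite rmorphM rmorphXn /= E exprZn -!exprM -scalerAl coefZ coefXnM ltnn subnn.
by [].
Qed.

Lemma closed_last_x_iter N m f : J (last_x ^+ m * f) ->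
  exists m', J (last_x ^+ m' * iter N P0 f).
Proof.
move=> Jf; elim: N => [|N [m' IH]]; first by exists m.
by exists (p * m')%N; apply: closed_last_x.
Qed.

Local Notation z := (fun j : 'I_s => 'X_(rshift r j) : T).
Local Notation conclusion := (contains_product r (xm k r s) z J).

Lemma mcoeff_zsum (c : 'I_s -> k) j : (\sum_i c i *: z i)@_U_(rshift r j) = c j.
Proof.
rewrite raddf_sum (bigD1 j) //= mcoeffZ mcoeffXU eqxx mulr1 big1 ?addr0 // => i ij.
by rewrite mcoeffZ mcoeffXU (inj_eq (@rshift_inj r s)) (negPf ij) mulr0.
Qed.

Lemma conclusionP m (us : seq T) :
  (forall u, u \in us ->
     u != 0 /\ exists c : 'I_s -> k, u = \sum_(j < s) c j *: z j) ->
  J (last_x ^+ m * \prod_(u <- us) u) -> conclusion.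
Proof. by move=> hus Jm; exists m, us; rewrite last_xX. Qed.

Lemma conclusion_linear m f : linear_form f -> f != 0 -> J (last_x ^+ m * f) ->
  conclusion.
Proof.
move=> [v ->] f0 Jf.
have iterE N : iter N P0 (\sum_a v a *: 'X_a) =
    \sum_a v a ^+ (p ^ N) *: shift_var N a.
  by rewrite iter_P0_sum; apply: eq_bigr => a _; rewrite iter_P0Z iter_P0_var.
(* If some z_j occurs, [r] shifts kill every x_i and keep a non-zero form in the z_j. *)
have [j vj|z0] := pickP (fun j => v (rshift r j) != 0).
  have [m'] := closed_last_x_iter r Jf; rewrite iterE big_split_ord /= big1 ?add0r.
    set u := \sum_(_ < _) _ => Ju.
    have uE : u = \sum_(j < s) v (rshift r j) ^+ (p ^ r) *: z j.
      by apply: eq_bigr => i _; rewrite /shift_var /= ltnNge leq_addr.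
    apply: (@conclusionP m' [:: u]); last by rewrite big_seq1.
    move=> w; rewrite inE => /eqP->; split; last first.
      by exists (fun j => v (rshift r j) ^+ (p ^ r)).
    apply/eqP=> u0.
    have /eqP := mcoeff_zsum (fun j => v (rshift r j) ^+ (p ^ r)) j.
    by rewrite -uE u0 mcoeff0 eq_sym expf_eq0 (negPf vj) andbF.
  by move=> i _; rewrite /shift_var /= ltn_ord xmE ltnNge leq_addl scaler0.
have [i0 vi0] : exists i, v (lshift s i) != 0.
  apply/existsP; apply: contra_neqT f0 => /existsPn v0.
  rewrite big_split_ord /= !big1 ?addr0 // => i _.
    by move/negbFE/eqP: (z0 i) => ->; rewrite scale0r.
  by move/negbNE/eqP: (v0 i) => ->; rewrite scale0r.
(* For the least [i] with non-zero coefficient, [r.-1 - i] shifts bring x_i to the last x variable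
   and push all later ones to zero. *)
case: (@arg_minnP _ i0 (fun i => v (lshift s i) != 0) val vi0) => i vi imin.
have r_gt0 : (0 < r)%N by apply: leq_ltn_trans (ltn_ord i).
have le_ir : (i <= r.-1)%N by rewrite -ltnS prednK.
have [m'] := closed_last_x_iter (r.-1 - i) Jf.
rewrite iterE big_split_ord /= addrC big1 ?add0r; last first.
  move=> j _; move/negbFE/eqP: (z0 j) => ->.
  by rewrite expr0n expn_eq0 (gtn_eqF p_gt0) scale0r.
rewrite (bigD1 i) //= big1 ?addr0; last first.
  move=> j ji; have [->|vj] := eqVneq (v (lshift s j)) 0.
    by rewrite expr0n expn_eq0 (gtn_eqF p_gt0) scale0r.
  have lt_ij : (i < j)%N by rewrite ltn_neqAle imin // andbT eq_sym.
  rewrite /shift_var /= ltn_ord xmE ltnNge.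
  rewrite (leq_trans _ (_ : r <= j + (r.-1 - i)))%N ?scaler0 //.
  by rewrite -[X in (X <= _)%N](prednK r_gt0) -{1}(subnKC le_ir) -addSn leq_add2r.
rewrite /shift_var /= ltn_ord subnKC // -last_xE //.
move/(JM (v (lshift s i) ^- (p ^ (r.-1 - i)))%:MP).
rewrite mul_mpolyC -scalerAr scalerA mulVf ?expf_neq0 // scale1r -exprSr => Jx.
by apply: (@conclusionP m'.+1 [::]); rewrite ?big_nil ?mulr1.
Qed.

(** * Linear forms in the z_j and their Moore systems *)

Definition zlin (v : 'rV[k]_s) : T := \sum_j v 0 j *: z j.

(** Row vectors form a group killed by [p], so [zlin] can serve as the map [G] of
    [moore_relation]. *)
Lemma zlin_is_additive : {morph zlin : u v / u - v}.
Proof.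
move=> u v; rewrite /zlin -sumrB; apply: eq_bigr => j _.
by rewrite !mxE scalerBl.
Qed.
HB.instance Definition _ := GRing.isAdditive.Build 'rV[k]_s T zlin zlin_is_additive.

Lemma zlin_neq0 v : v != 0 -> zlin v != 0.
Proof.
apply: contra_neq => v0; apply/rowP=> j.
by rewrite -(mcoeff_zsum (v 0)) -/(zlin v) v0 mcoeff0 mxE.
Qed.

(** The constant term, with coefficients raised to the power [p], stays anonymous: it does not
    affect the coefficient extracted in the next lemma. *)
Lemma total_zlin v : exists c, total (zlin v) = c%:P + (zlin v ^+ p) *: 'X^q.
Proof.
exists (\sum_j v 0 j ^+ p *: z j).
have := pexpr_sum pchar_mpoly 1 (index_enum 'I_s) xpredT (fun j => v 0 j *: z j).
rewrite expn1 /zlin => ->; rewrite !rmorph_sum scaler_suml -big_split.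
apply: eq_bigr => j _; rewrite /= totalZ totalX /total_gen /shift_var /= ltnNge leq_addr /=.
by rewrite exprZn scalerDr scalerA -!mul_mpolyC rmorphM /= mul_polyC.
Qed.

(** This is the coefficient of degree [q * p ^ m.+1] in the total power. The constant terms of the
    [L b] could only contribute through a term of that degree in [total (zlin (w b))], which has
    degrees 0 and [q] only; hence the exponents start at [p]. *)
Lemma closed_moore_step m n' (L w : 'I_n' -> 'rV[k]_s) (w_fixed : forall b,
    total (zlin (w b)) = (zlin (w b))%:P + (zlin (w b) ^+ p) *: 'X^q) :
  J (\sum_b zlin (L b) ^+ (p ^ m.+1) * zlin (w b)) ->
  J (\sum_b zlin (L b) ^+ (p ^ m.+2) * zlin (w b)).
Proof.
move/J_total/(_ (q * p ^ m.+1)%N).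
have pP : p \in [pchar {poly T}] := rmorph_pchar (@polyC T) pchar_mpoly.
have p_gt1 : (1 < p)%N := prime_gt1 (pcharf_prime hp).
rewrite rmorph_sum coef_sum.
rewrite (eq_bigr (fun b => zlin (L b) ^+ (p ^ m.+2) * zlin (w b))) // => b _.
have [c E] := total_zlin (L b).
rewrite rmorphM rmorphXn /= E w_fixed (pexprD pP) -rmorphXn exprZn -!exprM -expnS.
rewrite mulrDl coefD coefCM coefD coefC coefZ coefXn muln_eq0.
rewrite (gtn_eqF q_gt0) expn_eq0 (gtn_eqF p_gt0) /= -[X in (_ == X)]muln1.
rewrite eqn_pmul2l // (gtn_eqF (_ : 1 < p ^ m.+1)%N)
  ?(leq_trans p_gt1) ?expnS ?leq_pmulr ?expn_gt0 ?p_gt0 //.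
rewrite mulr0 addr0 mulr0 add0r -scalerAl coefZ -expnS coefXnM ltnn subnn.
by rewrite coef0_total_gen.
Qed.

(** The first hypothesis says that P^0 fixes the forms of the [w b]. It puts all rows of the Moore
    system in [J] before [moore_relation] changes the [w b]. *)
Lemma conclusion_moore n' (L w : 'I_n' -> 'rV[k]_s) :
  (forall b, total (zlin (w b)) = (zlin (w b))%:P + (zlin (w b) ^+ p) *: 'X^q) ->
  \sum_b zlin (L b) ^+ p * zlin (w b) != 0 ->
  J (\sum_b zlin (L b) ^+ p * zlin (w b)) -> conclusion.
Proof.
move=> w_fixed ne0 Jf.
pose S f := exists2 us : seq 'rV[k]_s, all (fun u => u != 0) us & f = \prod_(u <- us) zlin u.
have [] := @moore_relation T p 'rV[k]_s pchar_mpoly _ J S JD JM _ _ n' zlin L w.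
- by move=> v; apply/rowP=> j; rewrite mulmxnE mxE -mulr_natr pcharf0 // mulr0.
- by exists [::]; rewrite ?big_nil.
- move=> _ _ [us us0 ->] [vs vs0 ->]; exists (us ++ vs); last by rewrite big_cat.
  by rewrite all_cat us0.
- by move=> v v0; exists [:: v]; rewrite /= ?v0 // big_seq1.
- by elim=> [|m IH]; [rewrite expn1|apply: closed_moore_step].
- exact: ne0.
move=> _ [us us0 ->] Ju; apply: (@conclusionP 0 (map zlin us)); last first.
  by rewrite mul1r big_map.
move=> _ /mapP[v vus ->]; split; first exact/zlin_neq0/(allP us0).
by exists (v 0).
Qed.

(** * Combinations of twisted minors *)

Definition twisted_minor (N : nat) (P : 'I_n * 'I_n) : T :=
  shift_var N P.1 ^+ p * shift_var N.+1 P.2 - shift_var N.+1 P.1 * shift_var N P.2 ^+ p.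

Lemma iter_P0_twisted_minor N P :
  iter N P0 (twisted_minor 0 P) = twisted_minor N P.
Proof.
elim: N => //= N ->; rewrite rmorphB !rmorphM !rmorphXn /=.
by rewrite !P0_shift_var.
Qed.

(** The coefficients are kept as p-th powers so that they can be absorbed into p-th powers of linear
    forms. *)
Lemma iter_P0_minors N (g : 'I_n * 'I_n -> k) (Q : pred ('I_n * 'I_n)) :
  iter N P0 (\sum_(P | Q P) g P ^+ p *: twisted_minor 0 P) =
  \sum_(P | Q P) (g P ^+ (p ^ N)) ^+ p *: twisted_minor N P.
Proof.
rewrite iter_P0_sum; apply: eq_bigr => P _.
by rewrite iter_P0Z iter_P0_twisted_minor exprAC.
Qed.

(** The monomial z_a^p z_b determines the pair: since p > 1, the exponent reaches [p] at [a]
    only. *)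
Lemma mcoeff_zpz (i j a b : 'I_s) :
  (z a ^+ p * z b)@_(U_(rshift r i) *+ p + U_(rshift r j)) = ((a == i) && (b == j))%:R.
Proof.
rewrite /= mpolyXn -mpolyXD mcoeffX; congr (_ %:R); congr nat_of_bool.
apply/eqP/andP=> [/mnmP E|[/eqP-> /eqP->] //].
have p_gt1 : (1 < p)%N := prime_gt1 (pcharf_prime hp).
have Ez c : ((a == c) * p + (b == c) = (i == c) * p + (j == c))%N.
  by have := E (rshift r c); rewrite !mnmDE !mulmnE !mnm1E !(inj_eq (@rshift_inj r s)).
have ai : a == i.
  move: (Ez a); rewrite eqxx; rewrite [a == i]eq_sym; case: (i == a) => //.
  by case: (b == a); case: (j == a) => /= H; move: p_gt1; move: H; case: (p) => [|[|p']].
split=> //; move: (Ez b); rewrite eqxx (eqP ai) => /addnI.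
by rewrite [b == j]eq_sym; case: (j == b).
Qed.

Lemma conclusion_zz (g : 'I_n * 'I_n -> k) (P : 'I_n * 'I_n) :
  (r <= P.1 < P.2)%N -> g P != 0 ->
  J (\sum_(P : 'I_n * 'I_n | (P.1 < P.2)%N) g P ^+ p *: twisted_minor 0 P) -> conclusion.
Proof.
move=> /andP[r1 r2] gP /(closed_iter_P0 r); rewrite iter_P0_minors.
pose h (i j : 'I_s) := g (rshift r i, rshift r j) ^+ (p ^ r).
set f := \sum_(_ | _) _.
have {f}-> : f = \sum_(a < n) \sum_(b < n | (a < b)%N)
    (g (a, b) ^+ (p ^ r)) ^+ p *: twisted_minor r (a, b).
  by rewrite pair_big_dep; apply: eq_big => -[].
(* After [r] shifts every minor whose first variable is an x_i vanishes; as the pairs are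
   increasing, the others involve two z variables. *)
rewrite big_split_ord /= big1 ?add0r; last first.
  move=> a _; apply: big1 => b _; rewrite /twisted_minor /shift_var /= ltn_ord !xmE.
  have out N : (r <= N -> a + N < r = false)%N.
    by move=> le_rN; rewrite ltnNge (leq_trans le_rN) ?leq_addl.
  by rewrite !out // expr0n (gtn_eqF p_gt0) !mul0r subr0 scaler0.
set f := \sum_(_ < _) _.
have {f}-> : f = \sum_(i < s) \sum_(j < s | (i < j)%N)
    h i j ^+ p *: (z i ^+ p * z j - z i * z j ^+ p).
  apply: eq_bigr => i _; rewrite big_split_ord /= big1 ?add0r; last first.
    by move=> a /ltn_trans-/(_ _ (ltn_ord a)); rewrite ltnNge leq_addr.
  apply: eq_big => [j|j _]; first by rewrite ltn_add2l.
  by rewrite /twisted_minor /shift_var /= !ltnNge !leq_addr.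
(* The antisymmetric extension of [h] lets the sum of minors be regrouped as sum_j (sum_i c_ij
   z_i)^p z_j. *)
pose c (i j : 'I_s) := if (i < j)%N then h i j else if (j < i)%N then - h j i else 0.
pose L (j : 'I_s) : 'rV[k]_s := \row_i c i j.
pose w (j : 'I_s) : 'rV[k]_s := delta_mx 0 j.
have zw j : zlin (w j) = z j.
  rewrite /zlin (bigD1 j) //= mxE !eqxx scale1r big1 ?addr0 // => i ij.
  by rewrite mxE (negPf ij) andbF scale0r.
have fE : \sum_b zlin (L b) ^+ p * zlin (w b) =
    \sum_(j < s) \sum_(i < s) c i j ^+ p *: (z i ^+ p * z j).
  apply: eq_bigr => j _; rewrite zw.
  have := pexpr_sum pchar_mpoly 1 (index_enum 'I_s) xpredT (fun i => L j 0 i *: z i).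
  rewrite expn1 /zlin => ->; rewrite mulr_suml; apply: eq_bigr => i _.
  by rewrite mxE exprZn scalerAl.
set f := \sum_(_ < _) _.
have {f}-> : f = \sum_b zlin (L b) ^+ p * zlin (w b).
  pose m (i j : 'I_s) : T := z i ^+ p * z j.
  pose A (i j : 'I_s) := if (i < j)%N then h i j ^+ p *: m i j else 0.
  pose B (i j : 'I_s) := if (i < j)%N then - (h i j ^+ p *: m j i) else 0.
  have cE i j : c i j ^+ p *: m i j = A i j + B j i.
    rewrite /c /A /B; case: (ltngtP i j) => _; rewrite ?addr0 ?add0r //.
      by rewrite -[X in _ ^+ X]expn1 (pexprN hp) expn1 scaleNr.
    by rewrite expr0n (gtn_eqF p_gt0) scale0r.
  rewrite fE exchange_big /= [RHS](eq_bigr (fun i => \sum_j A i j + \sum_j B j i)); last first.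
    by move=> i _; rewrite -big_split; apply: eq_bigr => j _; exact: cE.
  rewrite big_split /= [X in _ = _ + X]exchange_big -big_split; apply: eq_bigr => i _.
  rewrite -big_split big_mkcond; apply: eq_bigr => j _; rewrite /= /A /B.
  by case: ifP => _; rewrite ?addr0 // scalerBr /m /= [_ ^+ p * 'X_(rshift r i)]mulrC.
apply: conclusion_moore.
  by move=> b; rewrite zw totalX /total_gen /shift_var /= ltnNge leq_addr.
have lt_s (a : 'I_n) : (r <= a -> a - r < s)%N by move=> ra; rewrite ltn_subLR.
have rsh (a : 'I_n) (ra : (r <= a)%N) : rshift r (Ordinal (lt_s a ra)) = a.
  by apply: val_inj; rewrite /= subnKC.
case: P => a b /= in r1 r2 gP *; have rb := leq_trans r1 (ltnW r2).
pose i := Ordinal (lt_s a r1); pose j := Ordinal (lt_s b rb).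
rewrite fE; apply: contra_neq gP.
move/(congr1 (mcoeff (U_(rshift r i) *+ p + U_(rshift r j)))).
rewrite raddf_sum (bigD1 j) //= raddf_sum (bigD1 i) //= !big1 ?addr0.
- rewrite mcoeffZ mcoeff_zpz !eqxx mulr1 mcoeff0 => /eqP.
  rewrite expf_eq0 p_gt0 /c /= ltn_sub2r ?(leq_ltn_trans r1) //.
  by rewrite /h !rsh expf_eq0 => /andP[_ /eqP].
- move=> j' jj; rewrite raddf_sum big1 // => i' _.
  by rewrite /= mcoeffZ mcoeff_zpz (negPf jj) andbF mulr0.
- by move=> i' ii; rewrite mcoeffZ mcoeff_zpz (negPf ii) mulr0.
Qed.

(* The minors that survive longest under P^0 become, just before they vanish, equal
   to x_r^p times a variable up to sign, and these variables are pairwise distinct. *)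
Lemma conclusion_minors (g : 'I_n * 'I_n -> k) (P : 'I_n * 'I_n) :
  (P.1 < P.2)%N -> g P != 0 ->
  J (\sum_(P : 'I_n * 'I_n | (P.1 < P.2)%N) g P ^+ p *: twisted_minor 0 P) ->
  conclusion.
Proof.
move=> ltP gP Jf.
have [Q /andP[zzQ gQ]|no_zz] := pickP
    (fun Q : 'I_n * 'I_n => (r <= Q.1 < Q.2)%N && (g Q != 0)).
  exact: conclusion_zz zzQ gQ Jf.
(* For a pair in [good], the minor [twisted_minor N Q] is non-zero exactly while [mu Q + N] is less
   than [r]. *)
pose mu (Q : 'I_n * 'I_n) : nat := if (Q.2 < r)%N then Q.2 else Q.1.
pose good (Q : 'I_n * 'I_n) := (Q.1 < Q.2)%N && (g Q != 0).
have goodP : good P by rewrite /good ltP.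
have good_x Q : good Q -> (Q.1 < r)%N.
  move=> /andP[lt gQ]; have := no_zz Q; rewrite lt gQ !andbT.
  by move/negbT; rewrite -ltnNge.
have {ltP gP P goodP} [P goodP mu_min] : exists2 P : 'I_n * 'I_n, good P &
    forall Q : 'I_n * 'I_n, good Q -> (mu P <= mu Q)%N.
  by case: (@arg_minnP _ P good mu goodP) => Q; exists Q.
have ltM : (mu P < r)%N.
  by have := good_x P goodP; rewrite /mu; case: ifP.
set M := mu P in ltM mu_min; pose N := (r.-1 - M)%N.
(* For [mu Q = M], [kappa Q] is the index of the variable that accompanies x_r^p after [N] shifts,
   and [d Q] its signed coefficient. *)
pose kappa (Q : 'I_n * 'I_n) : nat := if (Q.2 < r)%N then (Q.1 + N.+1)%N else Q.2.
pose c Q := (g Q ^+ (p ^ N)) ^+ p.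
pose d (Q : 'I_n * 'I_n) :=
  if mu Q == M then if (Q.2 < r)%N then - c Q else c Q else 0.
have c0 Q : (c Q == 0) = (g Q == 0).
  by rewrite /c !expf_eq0 expn_gt0 p_gt0.
have p0 : 0 ^+ p = 0 :> T by rewrite expr0n (gtn_eqF p_gt0).
have termE (Q : 'I_n * 'I_n) : (Q.1 < Q.2)%N ->
    c Q *: twisted_minor N Q = last_x ^+ p * (d Q *: var k n (kappa Q)).
  move=> ltQ; have [g0|gQ] := eqVneq (g Q) 0.
    have /eqP cQ : c Q == 0 by rewrite c0 g0.
    by rewrite /d cQ oppr0 !if_same !scale0r mulr0.
  have goodQ : good Q by rewrite /good ltQ.
  have Q1 := good_x Q goodQ; have {}mu_min := mu_min Q goodQ.
  rewrite /twisted_minor /d /kappa (last_xE (leq_ltn_trans (leq0n M) ltM)).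
  move: mu_min; rewrite /mu /shift_var Q1.
  have [Q2|Q2] := ltnP Q.2 r => leM.
    have -> : xm k r s (Q.2 + N.+1) = 0 by rewrite xmE ifF //; lia.
    rewrite mulr0 sub0r scalerN; case: eqP => [eM|neM]; last first.
      have -> : xm k r s (Q.2 + N) = 0 by rewrite xmE ifF //; lia.
      by rewrite p0 mulr0 scaler0 oppr0 scale0r mulr0.
    have -> : (Q.2 + N = r.-1)%N by lia.
    have -> : xm k r s (Q.1 + N.+1) = var k n (Q.1 + N.+1) by rewrite xmE ifT //; lia.
    by rewrite scaleNr mulrN -scalerAr mulrC.
  have -> : xm k r s (Q.1 + N.+1) = 0 by rewrite xmE ifF //; lia.
  rewrite mul0r subr0; case: eqP => [eM|neM]; last first.
    have -> : xm k r s (Q.1 + N) = 0 by rewrite xmE ifF //; lia.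
    by rewrite p0 mul0r scaler0 scale0r mulr0.
  have -> : (Q.1 + N = r.-1)%N by lia.
  by rewrite -scalerAr var_ord.
pose f := \sum_(Q : 'I_n * 'I_n | (Q.1 < Q.2)%N) d Q *: var k n (kappa Q).
have lt_kappa : (kappa P < n)%N.
  have h := ltn_ord P.2; have /andP[ltP _] := goodP; move: ltM.
  by rewrite /kappa /N /M /mu; case: ifP => // _ ltM; lia.
apply: (@conclusion_linear p f).
- apply: (big_ind (@linear_form k n)) => [||Q _].
  + exact: linear_form0.
  + exact: linear_formD.
  + exact/linear_formZ/linear_form_var.
- have /andP[ltP gP] := goodP.
  have dP : d P != 0 by rewrite /d eqxx; case: ifP; rewrite ?oppr_eq0 c0.
  apply: contra_neq dP => /(congr1 (mcoeff U_(Ordinal lt_kappa))).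
  rewrite mcoeff0 raddf_sum (bigD1 P) //= mcoeffZ mcoeff_var eqxx mulr1 big1 ?addr0 //.
  move=> Q /andP[ltQ neQP]; rewrite mcoeffZ mcoeff_var /= /d.
  case: eqP => [muQ|]; last by rewrite mul0r.
  have [g0|gQ] := eqVneq (g Q) 0.
    have /eqP cQ : c Q == 0 by rewrite c0 g0.
    by rewrite cQ oppr0 if_same mul0r.
  have goodQ : good Q by rewrite /good ltQ.
  case: eqP => kQ; last by rewrite mulr0.
  (* When [mu Q = M], the pair is recovered from [kappa Q]: it is [(kappa Q - N.+1, M)] if [kappa Q]
     is less than [r], and [(M, kappa Q)] otherwise. *)
  suff QP : Q = P by rewrite QP eqxx in neQP.
  have := good_x _ goodQ; have := good_x _ goodP; have := ltn_ord P.2.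
  move: ltM kQ muQ; rewrite /kappa /N /M /mu [Q in _ -> Q = _]surjective_pairing.
  rewrite [P in _ -> _ = P]surjective_pairing => ltM kQ muQ lt_P2 xP xQ.
  by congr (_, _); apply: val_inj; move: ltM kQ muQ => /=;
    case: ifP => h1; case: ifP => h2; lia.
rewrite mulr_sumr -(eq_bigr _ termE) -iter_P0_minors.
exact: closed_iter_P0.
Qed.

End TotalPower.

(** * From polynomials to an algebra with Steenrod operations *)

Section SteenrodModel.
Variables (k : fieldType) (p : nat).
Hypothesis hp : p \in [pchar k].
Variables (r s q : nat).
Local Notation n := (r + s)%N.
Local Notation T := {mpoly k[n]}.
Variables (A : algType k) (Op : nat -> A -> A).
Hypothesis Op_semilinear : forall j, semilinear_map p (Op j).
Hypothesis Op_cartan : forall l u v,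
  Op l (u * v) = \sum_(i < l.+1) Op i u * Op (l - i)%N v.

Lemma semilinear0 (F : A -> A) : semilinear_map p F -> F 0 = 0.
Proof. by case=> FD _; apply: (addrI (F 0)); rewrite -FD !addr0. Qed.

Lemma semilinearN (F : A -> A) u : semilinear_map p F -> F (- u) = - F u.
Proof.
by move=> hF; apply/eqP; rewrite -addr_eq0; case: (hF) => <- _; rewrite addNr semilinear0.
Qed.

Lemma semilinear_sum (F : A -> A) I (t : seq I) (Q : pred I) (G : I -> A) :
  semilinear_map p F -> F (\sum_(i <- t | Q i) G i) = \sum_(i <- t | Q i) F (G i).
Proof.
move=> hF; have [FD _] := hF; apply: (big_morph F FD); exact: semilinear0.
Qed.

(* The Cartan formula makes Op 0 1 idempotent; were it 0, then Op 0 would vanish,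
   and so would Op 1. *)
Lemma Op_one c w : Op 0 1 = c *: 1 -> Op 1 w != 0 -> forall j, Op j 1 = (j == 0%N)%:R.
Proof.
move=> Op01 Op1w.
have c1 : c = 1.
  have := Op_cartan 0 1 1; rewrite big_ord1 mulr1 Op01 -scalerAl mul1r scalerA => /eqP.
  rewrite -subr_eq0 -scalerBl scaler_eq0 oner_eq0 orbF -{1}[c]mulr1 -mulrBr mulf_eq0.
  case/orP=> [/eqP c0|]; last by rewrite subr_eq0 => /eqP.
  have Op0 v : Op 0 v = 0.
    by have := Op_cartan 0 1 v; rewrite big_ord1 mul1r Op01 c0 scale0r mul0r.
  have := Op_cartan 1 1 w; rewrite !big_ord_recl big_ord0 mul1r /= Op01 c0.
  by rewrite scale0r mul0r subnn Op0 mulr0 !addr0 => E; rewrite E eqxx in Op1w.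
have Op01' : Op 0 1 = 1 by rewrite Op01 c1 scale1r.
elim/ltn_ind=> -[|j] IH //=.
have := Op_cartan j.+1 1 1; rewrite mulr1 big_ord_recl big_ord_recr /= subn0 subnn.
rewrite Op01' mul1r mulr1 big1 => [|i _]; last first.
  by rewrite (IH (bump 0 i)) ?mul0r // /bump /= add1n ltnS.
by rewrite add0r -{1}[Op _ 1]addr0 => /addrI.
Qed.

Hypothesis Op_1 : forall j, Op j 1 = (j == 0%N)%:R.
(** For odd [p] this will be the inclusion of the polynomial part, for p = 2 the substitution of
    squares for the variables. *)
Variable iota : {rmorphism T -> A}.
Hypothesis iotaZ : forall c f, iota (c *: f) = c *: iota f.
Hypothesis Op_iotaX : forall j (a : 'I_n),
  Op j (iota 'X_a) = iota (total_gen k p q a)`_j.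

(** Semilinearity, the Cartan formula and the value on 1 reduce the claim to the generators. *)
Lemma Op_iota f j : Op j (iota f) = iota (total hp q f)`_j.
Proof.
pose ok g := forall j, Op j (iota g) = iota (total hp q g)`_j.
have ok1 : ok 1.
  by move=> i; rewrite !rmorph1 Op_1 coef1; case: eqP; rewrite ?rmorph1 ?rmorph0.
have okM g h : ok g -> ok h -> ok (g * h).
  move=> okg okh i; rewrite !rmorphM Op_cartan coefM rmorph_sum.
  by apply: eq_bigr => l _; rewrite rmorphM okg okh.
suff : ok f by [].
rewrite [f]mpolyE; elim/big_ind: _ => [i|g h okg okh i|m _ i].
- by rewrite !rmorph0 semilinear0 // coef0 rmorph0.
- by rewrite !rmorphD (Op_semilinear i).1 okg okh coefD rmorphD.
rewrite iotaZ (Op_semilinear i).2 totalZ coefZ mul_mpolyC iotaZ; congr (_ *: _).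
suff : ok 'X_[m] by apply.
have -> : 'X_[m] = \prod_a 'X_a ^+ m a :> T by rewrite [LHS]mpolyXE_id.
apply: (big_ind ok ok1 okM) => a _.
elim: (m a) => [|e IH]; first by rewrite expr0; apply: ok1.
by rewrite exprS; apply: okM IH => l; rewrite Op_iotaX totalX.
Qed.

Variable I : A -> Prop.
Hypotheses (I_ideal : is_ideal I) (I_stable : forall j, stable_under (Op j) I).
Hypothesis q_gt0 : (0 < q)%N.
Variables (x : nat -> A) (z : 'I_s -> A).
Hypothesis iota_x : forall i, iota (xm k r s i) = x i.
Hypothesis iota_z : forall j, iota 'X_(rshift r j) = z j.
Hypothesis z_free : forall c : 'I_s -> k, \sum_j c j *: z j = 0 -> forall j, c j = 0.

Lemma contains_product_transfer :
  contains_product r (xm k r s) (fun j => 'X_(rshift r j)) (fun f => I (iota f)) ->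
  contains_product r x z I.
Proof.
move=> [m [us [hus Ius]]]; exists m, (map iota us); split.
  move=> _ /mapP[u /hus[u0 [c uE]] ->].
  have iu : iota u = \sum_j c j *: z j.
    by rewrite uE rmorph_sum; apply: eq_bigr => j _; rewrite iotaZ iota_z.
  split; last by exists c.
  apply: contra_neq u0; rewrite iu => /z_free c0.
  by rewrite uE big1 // => j _; rewrite c0 scale0r.
rewrite big_map -rmorph_prod; suff <- : iota (if r is r'.+1 then xm k r s r' ^+ m else 1)
    = (if r is r'.+1 then x r' ^+ m else 1) by rewrite -rmorphM.
suff E c : iota (if c is r'.+1 then xm k r s r' ^+ m else 1) =
    (if c is r'.+1 then x r' ^+ m else 1).
  exact: E.
by case: c => [|c]; rewrite ?rmorph1 // rmorphXn /= iota_x.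
Qed.

(** The [E P] are the products of two degree one generators, and [eps] collects the signs of the
    Bocksteins. Some [c P] is non-zero and the minors apply, or [u] is itself a linear form. *)
Lemma contains_product_of_minors (u : A) (f : T) (c eps : 'I_n * 'I_n -> k)
    (E : 'I_n * 'I_n -> A) :
  I u -> u != 0 -> linear_form f ->
  u = iota f + \sum_(P : 'I_n * 'I_n | (P.1 < P.2)%N) c P *: E P ->
  (forall P, eps P != 0) ->
  I (iota (\sum_(P : 'I_n * 'I_n | (P.1 < P.2)%N)
       (c P ^+ p * eps P) ^+ p *: twisted_minor k p 0 P)) ->
  contains_product r x z I.
Proof.
case: I_ideal => I0 ID IM Iu u0 lin_f uE eps0 Iminors.
have JD g h : I (iota g) -> I (iota h) -> I (iota (g + h)).
  by rewrite rmorphD; apply: ID.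
have JM g h : I (iota h) -> I (iota (g * h)).
  by rewrite rmorphM => /IM-/(_ (iota g))[].
have J_total g : I (iota g) -> forall j, I (iota (total hp q g)`_j).
  by move=> Ig j; rewrite -Op_iota; apply: I_stable.
apply: contains_product_transfer.
have [P /andP[ltP cP]|c0] := pickP (fun P : 'I_n * 'I_n => (P.1 < P.2)%N && (c P != 0)).
  apply: (conclusion_minors (hp := hp) q_gt0 JD JM J_total ltP _ Iminors).
  by rewrite mulf_neq0 ?expf_neq0.
have uf : u = iota f.
  rewrite uE big1 ?addr0 // => P ltP; have := c0 P; rewrite ltP /=.
  by move/negbFE/eqP->; rewrite scale0r.
apply: (conclusion_linear (hp := hp) q_gt0 JM J_total (m := 0) lin_f).
  by apply: contra_neq u0; rewrite uf => ->; rewrite rmorph0.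
by rewrite mul1r -uf.
Qed.

End SteenrodModel.

(** * Decomposition of degree two elements *)

Section QuadraticDecomposition.
Variables (k : fieldType) (n : nat) (A : algType k).
Variables (iota : {additive {mpoly k[n]} -> A}) (E : 'I_n * 'I_n -> A).

Definition quadratic (u : A) : Prop := exists f (c : 'I_n * 'I_n -> k),
  linear_form f /\ u = iota f + \sum_(P : 'I_n * 'I_n | (P.1 < P.2)%N) c P *: E P.

Lemma quadratic_linear f : linear_form f -> quadratic (iota f).
Proof.
move=> lin_f; exists f, (fun=> 0); split=> //.
by rewrite big1 ?addr0 // => P _; rewrite scale0r.
Qed.

Lemma quadratic0 : quadratic 0.
Proof. by rewrite -(raddf0 iota); apply/quadratic_linear/linear_form0. Qed.

Lemma quadraticD u v : quadratic u -> quadratic v -> quadratic (u + v).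
Proof.
move=> [f [c [lin_f ->]]] [g [d [lin_g ->]]]; exists (f + g), (fun P => c P + d P).
split; first exact: linear_formD.
rewrite raddfD addrACA -big_split; congr (_ + _).
by apply: eq_bigr => P _; rewrite scalerDl.
Qed.

Lemma quadratic_term c (P : 'I_n * 'I_n) : (P.1 < P.2)%N -> quadratic (c *: E P).
Proof.
move=> ltP; exists 0, (fun Q => if Q == P then c else 0); split; first exact: linear_form0.
rewrite raddf0 add0r (bigD1 P) //= eqxx big1 ?addr0 // => Q /andP[_ /negPf->].
by rewrite scale0r.
Qed.

(** This supplies a generator on which the operation of index 1 is non-zero, as [Op_one]
    requires. *)
Lemma quadratic_neq0 u : quadratic u -> u != 0 -> exists a : 'I_n, true.
Proof.
case=> f [c [[v ->] ->]] u0; have [a _|no] := pickP (xpredT : pred 'I_n); first by exists a.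
case/eqP: u0; rewrite !big1 ?raddf0 ?addr0 // => [[a]|a]; by have := no a.
Qed.

End QuadraticDecomposition.

Lemma mdeg2P n (m : 'X_{1..n}) : mdeg m = 2%N ->
  exists a b : 'I_n, m = (U_(a) + U_(b))%MM.
Proof.
move=> m2; have [a ma] : exists a, m a != 0%N.
  apply/existsP; apply: contra_eqT m2 => /existsPn m0.
  by rewrite mdegE big1 // => a _; apply/eqP/negbNE/m0.
have le_am : (U_(a) <= m)%MM.
  by apply/mnm_lepP=> b; rewrite mnm1E; case: eqP => // <-; rewrite lt0n.
have /eqP/mdeg1P[b /eqP E] : mdeg (m - U_(a))%MM = 1%N.
  by have := m2; rewrite -{1}(submK le_am) mdegD mdeg1; lia.
by exists a, b; rewrite -E addmC submK.
Qed.

Lemma mpolyvar_neq0 (k : fieldType) n (a : 'I_n) : 'X_a != 0 :> {mpoly k[n]}.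
Proof.
apply/eqP=> /(congr1 (mcoeff U_(a)))/eqP.
by rewrite mcoeffXU eqxx mcoeff0 oner_eq0.
Qed.

Lemma coef_total_gen (k : fieldType) (p r s q j : nat) (a : 'I_(r + s)) :
  (0 < q)%N -> (total_gen k p q a)`_j =
  if j == 0%N then shift_var k 1 a else if j == q then 'X_a ^+ p else 0.
Proof.
move=> q_gt0; rewrite coefD coefC coefZ coefXn; case: eqP => [->|_].
  by rewrite (ltn_eqF q_gt0) mulr0 addr0.
by case: eqP; rewrite ?mulr1 ?mulr0 add0r.
Qed.

(** * Odd primes *)

Section OddPrime.
Import SteenrodExistence.
Variables (k : fieldType) (p : nat).
Hypothesis hp : p \in [pchar k].
Variables (r s : nat).
Local Notation n := (r + s)%N.
Local Notation H := (Hodd k r s).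
Local Notation cst := (@SteenrodExistence.ext_cst k n).
Variables P bP : nat -> H -> H.
Hypothesis hS : steenrod_odd p P bP.

Definition beta_sign (a : 'I_n) : k := if (a < r)%N then -1 else 1.

Lemma ext_cstZ c (f : {mpoly k[n]}) : cst (c *: f) = c *: cst f.
Proof. by rewrite -mul_mpolyC rmorphM /= SteenrodExistence.ext_cstC. Qed.

Lemma cst_inj : injective cst.
Proof. by move=> f g /ffunP/(_ set0); rewrite !ffunE eqxx !mulr1n. Qed.

Lemma odd_x_ord (i : 'I_r) : odd_x k r s i = cst 'X_(lshift s i).
Proof. by rewrite odd_xE xmE ltn_ord -(var_ord k (lshift s i)). Qed.

Lemma ext_e_mul (a b : 'I_n) : (a < b)%N -> ext_e k a * ext_e k b = ext_term 1 [set a; b].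
Proof.
move=> ab; rewrite [LHS]ext_mul_term /ext_sign disjoints_subset sub1set !inE.
have -> : a != b by apply: contraTneq ab => ->; rewrite ltnn.
by rewrite /inversions !big_set1 ltnNge (ltnW ab) expr0 !mulr1.
Qed.

Lemma odd_homog0P (u : H) : odd_homog 0 u -> exists c, u = c *: 1.
Proof.
rewrite /odd_homog; elim/ext_homog_ind => [|_ _ [c ->] [d ->]|c m S dS].
- by exists 0; rewrite scale0r.
- by exists (c + d); rewrite scalerDl.
have /eqP : mdeg m = 0%N by lia.
have /eqP : #|S| = 0%N by lia.
rewrite cards_eq0 mdeg_eq0 => /eqP-> /eqP->; exists c.
by rewrite mpolyX0 -[LHS]/(cst _) ext_cstZ rmorph1.
Qed.

Lemma P_cstX j (a : 'I_n) : P j (cst 'X_a) = cst (total_gen k p 1 a)`_j.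
Proof.
rewrite coef_total_gen //; case: (split_ordP a) => [i|i] ->.
  rewrite -odd_x_ord /shift_var /= ltn_ord addn1.
  case: j => [|[|j]] /=; first by rewrite (P0_x hS) // odd_xE.
    by rewrite (P1_x hS) // rmorphXn odd_x_ord.
  by rewrite (Pn_x hS) // rmorph0.
rewrite /shift_var /= ltnNge leq_addr /= -[cst _]/(odd_z k r i).
case: j => [|[|j]] /=; first exact: (P0_z hS).
  by rewrite (P1_z hS) // rmorphXn.
by rewrite (Pn_z hS) // rmorph0.
Qed.

Lemma bP_cstX j (a : 'I_n) : bP j (cst 'X_a) = 0.
Proof.
case: (split_ordP a) => [i|i] ->.
  rewrite -odd_x_ord; case: j => [|j]; first exact: (bP0_x hS).
  exact: (bPn_x hS).
by rewrite -[cst _]/(odd_z k r i); case: j => [|j]; [exact: (bP0_z hS)|exact: (bPn_z hS)].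
Qed.

Lemma ext_eE (a : 'I_n) : ext_e k a =
  if (a < r)%N then odd_lambda k r s a else ext_e k a.
Proof.
by case: (split_ordP a) => [i|i] -> //; rewrite /odd_lambda valK.
Qed.

Lemma P_e j (a : 'I_n) : P j (ext_e k a) =
  if j == 0%N then if (a < r)%N then odd_lambda k r s a.+1 else ext_e k a else 0.
Proof.
rewrite [X in P j X]ext_eE; case: ltnP => [a_r|]; last first.
  case: (split_ordP a) => [i|i] ->; first by rewrite /= leqNgt ltn_ord.
  move=> _; rewrite -[ext_e _ _]/(odd_y k r i).
  by case: j => [|j]; [exact: (P0_y hS)|exact: (Pn_y hS)].
by case: j => [|j]; [exact: (P0_lambda hS)|exact: (Pn_lambda hS)].
Qed.

Lemma bP_e j (a : 'I_n) : bP j (ext_e k a) =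
  if j == 0%N then beta_sign a *: cst 'X_a else 0.
Proof.
rewrite /beta_sign; case: (split_ordP a) => [i|i] ->; last first.
  rewrite -[ext_e _ _]/(odd_y k r i) scale1r.
  by case: j => [|j]; [exact: (bP0_y hS)|exact: (bPn_y hS)].
rewrite ext_eE /= ltn_ord.
case: j => [|j]; last exact: (bPn_lambda hS).
by rewrite (bP0_lambda hS) // -odd_x_ord scaleN1r.
Qed.

(** One formula covers the last lambda as well: P^0 kills it, and the shift kills the last x. *)
Lemma bP_P0_e j (a : 'I_n) : bP j (P 0 (ext_e k a)) =
  if j == 0%N then beta_sign a *: cst (shift_var k 1 a) else 0.
Proof.
rewrite P_e /= /shift_var /beta_sign; case: ifP => a_r; last first.
  by rewrite bP_e /beta_sign a_r.
rewrite addn1 -odd_xE; have [a1_r|r_a1] := ltnP a.+1 r; last first.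
  have -> : odd_lambda k r s a.+1 = 0 by rewrite /odd_lambda insubN // -leqNgt.
  rewrite (semilinear0 (bP_semilinear hS j)) odd_xE xmE ltnNge r_a1 rmorph0.
  by rewrite scaler0 if_same.
case: j => [|j]; last exact: (bPn_lambda hS).
by rewrite (bP0_lambda hS) // scaleN1r.
Qed.

Lemma beta_signX (a : 'I_n) : beta_sign a ^+ p = beta_sign a.
Proof.
rewrite /beta_sign; case: ifP => _; last by rewrite expr1n.
by have := pexprN hp 1 (1 : k); rewrite expn1 expr1n.
Qed.

(** By the Cartan formula, beta P^0 gives X_a P^0(e_b) - X_b P^0(e_a) up to signs. As all beta P^j
    vanish on the X_d, beta P^1 of X_d P^0(e_c) is P^1(X_d) = X_d^p times the Bockstein of
    P^0(e_c). *)
Lemma bP1_bP0_e (a b : 'I_n) : bP 1 (bP 0 (ext_e k a * ext_e k b)) =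
  (beta_sign a * beta_sign b) *: cst (twisted_minor k p 0 (a, b)).
Proof.
have homog_e : odd_homog 1 (ext_e k a).
  have := @ext_homog_term k n 1 0%MM [set a].
  by rewrite mdeg0 cards1 scale1r mpolyX0.
have homog_X (d : 'I_n) : odd_homog 2 (cst 'X_d) by exact: homog_X.
have step (d e : 'I_n) : bP 1 (cst 'X_d * P 0 (ext_e k e)) =
    beta_sign e *: cst ('X_d ^+ p * shift_var k 1 e).
  rewrite (bP_cartan hS _ _ (homog_X d)) !big_ord_recl big_ord0 /= !bP_cstX.
  rewrite !mul0r !add0r addr0 expr2 mulrNN !mul1r !bP_P0_e /= mulr0 add0r.
  by rewrite P_cstX coef_total_gen //= -scalerAr -rmorphM.
rewrite (bP_cartan hS _ _ homog_e) big_ord1 /= !bP_e /= expr1 mulN1r.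
rewrite -[P 0 (ext_e k a) * _]scalerAr -ext_cst_comm -scalerAl.
rewrite (bP_semilinear hS 1).1 (semilinearN _ (bP_semilinear hS 1)).
rewrite !(bP_semilinear hS 1).2 !step !beta_signX !scalerA [beta_sign b * _]mulrC -scalerBr.
by rewrite -rmorphB /twisted_minor /= !shift_var0 [shift_var k 1 a * _]mulrC.
Qed.

Lemma odd_quadratic (u : H) : odd_homog 2 u ->
  quadratic cst (fun Q : 'I_n * 'I_n => ext_e k Q.1 * ext_e k Q.2) u.
Proof.
rewrite /odd_homog; elim/ext_homog_ind.
- exact: quadratic0.
- exact: quadraticD.
move=> c m S dS; have [m0|m1] := posnP (mdeg m).
  have cS : #|S| = 2%N by rewrite m0 in dS.
  have [a [b [ab SE]]] : exists a b : 'I_n, (a < b)%N /\ S = [set a; b].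
    have /cards2P[a [b [ab ->]]] : #|S| == 2%N by rewrite cS.
    have [lt|lt|/val_inj E] := ltngtP (a : nat) b; first by exists a, b.
      by exists b, a; rewrite setUC.
    by rewrite E eqxx in ab.
  have -> : ext_term (c *: 'X_[m]) S = c *: (ext_e k a * ext_e k b).
    move/eqP: m0; rewrite mdeg_eq0 => /eqP->.
    rewrite ext_e_mul // SE mpolyX0; apply/ffunP=> U; rewrite !ffunE.
    by rewrite scalerMnr.
  exact: (@quadratic_term _ _ _ _ _ c (a, b)).
have m_1 : mdeg m = 1%N by lia.
have S0 : S = set0 by apply/eqP; rewrite -cards_eq0; lia.
have /eqP/mdeg1P[a /eqP ->] := m_1.
rewrite S0; apply: quadratic_linear; rewrite -var_ord.
exact/linear_formZ/linear_form_var.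
Qed.

Lemma contains_product_odd (I : H -> Prop) :
  is_ideal I -> (forall j, stable_under (P j) I) -> (forall j, stable_under (bP j) I) ->
  (exists u, [/\ I u, u <> 0 & odd_homog 2 u]) ->
  contains_product r (@odd_x k r s) (@odd_z k r s) I.
Proof.
move=> I_ideal P_stable bP_stable [u [Iu /eqP u0 u2]].
have [f [c [lin_f uE]]] := odd_quadratic u2.
have [a _] := quadratic_neq0 (odd_quadratic u2) u0.
have Pw : P 1 (cst 'X_a) != 0.
  rewrite P_cstX coef_total_gen //= -(rmorph0 cst) (inj_eq cst_inj).
  by rewrite expf_neq0 // mpolyvar_neq0.
(* P^0 preserves degree zero, where the cohomology is reduced to the scalars. *)
have [e Pe] : exists e, P 0 1 = e *: 1.
  apply: odd_homog0P; rewrite -[0%N]/(0 + 2 * 0 * (p - 1))%N; apply: (P_homog hS).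
  have := @ext_homog_term k n 1 0%MM set0.
  by rewrite mdeg0 cards0 scale1r mpolyX0.
apply: (contains_product_of_minors (p := p) hp (P_semilinear hS) (P_cartan hS)
  (Op_one (P_cartan hS) Pe Pw) ext_cstZ P_cstX I_ideal P_stable isT _ _ _
  Iu u0 lin_f uE (eps := fun Q => beta_sign Q.1 * beta_sign Q.2)).
- by move=> i; rewrite odd_xE.
- by [].
- move=> d d0 j; rewrite -(mcoeff_zsum r d j).
  suff -> : \sum_i d i *: 'X_(rshift r i) = 0 :> {mpoly k[n]} by rewrite mcoeff0.
  apply: cst_inj; rewrite rmorph0 rmorph_sum -[RHS]d0.
  by apply: eq_bigr => i _; rewrite /= ext_cstZ.
- by move=> Q; rewrite mulf_neq0 // /beta_sign; case: ifP; rewrite ?oppr_eq0 oner_eq0.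
have := bP_stable 1%N _ (bP_stable 0%N _ Iu); rewrite uE.
rewrite (bP_semilinear hS 0).1 (semilinear_sum _ _ _ (bP_semilinear hS 0)).
have -> : bP 0 (cst f) = 0.
  case: lin_f => v ->; rewrite rmorph_sum (semilinear_sum _ _ _ (bP_semilinear hS 0)).
  by rewrite big1 // => b _; rewrite /= ext_cstZ (bP_semilinear hS 0).2 bP_cstX scaler0.
rewrite add0r (semilinear_sum _ _ _ (bP_semilinear hS 1)) rmorph_sum.
rewrite (eq_bigr (fun Q => cst (
  (c Q ^+ p * (beta_sign Q.1 * beta_sign Q.2)) ^+ p *: twisted_minor k p 0 Q))) //.
move=> [a' b'] _; rewrite (bP_semilinear hS 0).2 (bP_semilinear hS 1).2 bP1_bP0_e.
by rewrite scalerA ext_cstZ !exprMn !beta_signX.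
Qed.

End OddPrime.

(** * The prime two *)

Section PrimeTwo.
Variables (k : fieldType).
Hypothesis hp : 2%N \in [pchar k].
Variables (r s : nat).
Local Notation n := (r + s)%N.
Local Notation T := {mpoly k[n]}.
Variable Sq : nat -> T -> T.
Hypothesis hS : steenrod_two Sq.

Definition square_vars : T -> T := mmap (@mpolyC n k) (fun a => 'X_a ^+ 2).
HB.instance Definition _ := GRing.RMorphism.on square_vars.

Lemma square_varsX a : square_vars 'X_a = 'X_a ^+ 2.
Proof. by rewrite [LHS](mmapX (fun a => 'X_a ^+ 2)) mmap1U. Qed.

Lemma square_varsZ c f : square_vars (c *: f) = c *: square_vars f.
Proof.
by rewrite -!mul_mpolyC rmorphM; congr (_ * _); apply: mmapC.
Qed.

Lemma square_vars_xm i : square_vars (xm k r s i) = two_x k r s i.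
Proof.
rewrite /two_x /xm /two_lambda; case: insubP => [a _ _|_]; first exact: square_varsX.
by rewrite rmorph0 expr0n.
Qed.

Lemma two_homog0P (u : T) : two_homog 0 u -> exists c, u = c *: 1.
Proof.
move=> hu; rewrite [u]mpolyE big_seq.
apply: (big_ind (fun v => exists c, v = c *: 1)) => [|_ _ [c ->] [d ->]|m mu].
- by exists 0; rewrite scale0r.
- by exists (c + d); rewrite scalerDl.
have /eqP := dhomog_mf hu mu; rewrite /= mdeg_eq0 => /eqP ->.
by exists u@_0%MM; rewrite mpolyX0.
Qed.

Lemma two_quadratic (u : T) : two_homog 2 u ->
  quadratic square_vars (fun Q : 'I_n * 'I_n => 'X_Q.1 * 'X_Q.2) u.
Proof.
move=> hu; rewrite [u]mpolyE big_seq.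
apply: big_ind => [||m mu]; [exact: quadratic0|exact: quadraticD|].
have [a [b ->]] := mdeg2P (dhomog_mf hu mu).
rewrite mpolyXD; have [lt|lt|/val_inj ->] := ltngtP (a : nat) b.
- exact: (@quadratic_term _ _ _ _ _ _ (a, b)).
- by rewrite mulrC; apply: (@quadratic_term _ _ _ _ _ _ (b, a)).
rewrite -expr2 -square_varsX -square_varsZ; apply: quadratic_linear.
by rewrite -var_ord; apply/linear_formZ/linear_form_var.
Qed.

Definition Sq0_var (a : 'I_n) : T := if (a < r)%N then two_lambda k r s a.+1 else 'X_a.

Lemma var_cases (a : 'I_n) : 'X_a =
  if (a < r)%N then two_lambda k r s a else 'X_a.
Proof. by case: (split_ordP a) => [i|i] -> //; rewrite /two_lambda valK. Qed.

Lemma Sq_var j (a : 'I_n) : Sq j 'X_a =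
  if j == 0%N then Sq0_var a else if j == 1%N then 'X_a ^+ 2 else 0.
Proof.
rewrite [X in Sq j X]var_cases [X in X ^+ 2]var_cases /Sq0_var.
case: (split_ordP a) => [i|i] ->.
  case: j => [|[|j]] /=; [exact: (Sq0_lambda hS)|exact: (Sq1_lambda hS)|].
  exact: (Sqn_lambda hS).
by case: j => [|[|j]] /=; [exact: (Sq0_y hS)|exact: (Sq1_y hS)|exact: (Sqn_y hS)].
Qed.

Lemma Sq_Sq0_var j (a : 'I_n) : (0 < j)%N ->
  Sq j (Sq0_var a) = if j == 1%N then Sq0_var a ^+ 2 else 0.
Proof.
rewrite /Sq0_var; case: ifP => a_r; last by rewrite Sq_var; case: j.
have [a1_r|r_a1] := ltnP a.+1 r; last first.
  have -> : two_lambda k r s a.+1 = 0 by rewrite /two_lambda insubN // -leqNgt.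
  by rewrite (semilinear0 (Sq_semilinear hS j)) expr0n if_same.
by case: j => [|[|j]] //= _; [exact: (Sq1_lambda hS)|exact: (Sqn_lambda hS)].
Qed.

Lemma square_vars_shift (a : 'I_n) : square_vars (shift_var k 1 a) = Sq0_var a ^+ 2.
Proof.
rewrite /shift_var /Sq0_var; case: ifP => _; last exact: square_varsX.
by rewrite addn1 square_vars_xm.
Qed.

Lemma addrr_two (f : T) : f + f = 0.
Proof. by rewrite -mulr2n -mulr_natr pcharf0 ?mulr0 //; apply: pchar_mpoly. Qed.

(** On a square the two cross terms of Sq^1 cancel in characteristic two, and Sq^2 squares again;
    hence [q = 2]. *)
Lemma Sq_square_var j (a : 'I_n) :
  Sq j (square_vars 'X_a) = square_vars (total_gen k 2 2 a)`_j.
Proof.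
rewrite coef_total_gen // square_varsX expr2 (Sq_cartan hS).
case: j => [|[|[|j]]] /=.
- by rewrite big_ord1 subn0 !Sq_var -expr2 square_vars_shift.
- by rewrite !big_ord_recl big_ord0 /= !Sq_var /= addr0 mulrC addrr_two rmorph0.
- rewrite !big_ord_recl big_ord0 /= !Sq_var /= mulr0 mul0r add0r !addr0.
  by rewrite rmorphM /= !square_varsX.
by rewrite rmorph0 big1 // => -[[|[|i]] lt_i] _ /=; rewrite !Sq_var /= ?mulr0 ?mul0r.
Qed.

(** Sq^1 gives P^0(X_a) X_b^2 + X_a^2 P^0(X_b) with P^0 = Sq^0. In Sq^3 of such a term only Sq^2 of
    the square times Sq^1 of the other factor survives. *)
Lemma Sq3_Sq1_var (a b : 'I_n) : Sq 3 (Sq 1 ('X_a * 'X_b)) =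
  square_vars (twisted_minor k 2 0 (a, b)).
Proof.
have step (d e : 'I_n) : Sq 3 ('X_d ^+ 2 * Sq0_var e) =
    square_vars ('X_d ^+ 2 * shift_var k 1 e).
  rewrite -square_varsX (Sq_cartan hS) !big_ord_recl big_ord0 /= !Sq_square_var.
  rewrite !coef_total_gen //= !rmorph0 !mul0r !add0r !addr0 !Sq_Sq0_var //= mulr0 add0r.
  by rewrite square_varsX [RHS]rmorphM /= square_vars_shift.
rewrite (Sq_cartan hS) !big_ord_recl big_ord0 /= !Sq_var /= addr0.
rewrite (Sq_semilinear hS 3).1 [Sq0_var a * _]mulrC !step -rmorphD.
rewrite /twisted_minor /= !shift_var0; congr (square_vars _).
rewrite [RHS]addrC [shift_var k 1 a * _]mulrC; congr (_ + _).
by apply/eqP; rewrite -addr_eq0 addrr_two.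
Qed.

Lemma contains_product_two (I : T -> Prop) :
  is_ideal I -> (forall j, stable_under (Sq j) I) ->
  (exists u, [/\ I u, u <> 0 & two_homog 2 u]) ->
  contains_product r (@two_x k r s) (@two_z k r s) I.
Proof.
move=> I_ideal Sq_stable [u [Iu /eqP u0 u2]].
have [f [c [lin_f uE]]] := two_quadratic u2.
have [a _] := quadratic_neq0 (two_quadratic u2) u0.
have Sq1a : Sq 1 'X_a != 0 by rewrite Sq_var /= expf_neq0 // mpolyvar_neq0.
have [e Sqe] : exists e, Sq 0 1 = e *: 1.
  by apply: two_homog0P; apply: (Sq_homog hS 0 (d := 0)); apply: dhomog1.
apply: (contains_product_of_minors (p := 2) hp (Sq_semilinear hS) (Sq_cartan hS)
  (Op_one (Sq_cartan hS) Sqe Sq1a) square_varsZ Sq_square_var I_ideal Sq_stable isT _ _ _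
  Iu u0 lin_f uE (eps := fun=> 1)).
- exact: square_vars_xm.
- by move=> j; apply: square_varsX.
- move=> d d0 j; have := congr1 (mcoeff (U_(rshift r j) *+ 2)) d0.
  rewrite mcoeff0 raddf_sum (bigD1 j) //= mcoeffZ /two_z /two_y mpolyXn mcoeffX eqxx.
  rewrite mulr1 big1 ?addr0 // => i ij; rewrite mcoeffZ mpolyXn mcoeffX.
  case: eqP => [/mnmP/(_ (rshift r j))|]; last by rewrite mulr0.
  by rewrite !mulmnE !mnm1E !(inj_eq (@rshift_inj r s)) (negPf ij) eqxx.
- by move=> _; apply: oner_neq0.
have := Sq_stable 3%N _ (Sq_stable 1%N _ Iu); rewrite uE /=.
rewrite (Sq_semilinear hS 1).1.
have -> : Sq 1 (square_vars f) = 0.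
  case: lin_f => v ->; rewrite rmorph_sum (semilinear_sum _ _ _ (Sq_semilinear hS 1)).
  rewrite big1 // => b _; rewrite /= square_varsZ (Sq_semilinear hS 1).2 Sq_square_var.
  by rewrite coef_total_gen //= rmorph0 scaler0.
rewrite add0r (semilinear_sum _ _ _ (Sq_semilinear hS 1)).
rewrite (semilinear_sum _ _ _ (Sq_semilinear hS 3)) rmorph_sum.
rewrite (eq_bigr (fun Q => square_vars ((c Q ^+ 2 * 1) ^+ 2 *: twisted_minor k 2 0 Q))) //.
move=> [a' b'] _; rewrite (Sq_semilinear hS 1).2 (Sq_semilinear hS 3).2 Sq3_Sq1_var.
by rewrite mulr1 square_varsZ.
Qed.

End PrimeTwo.

Theorem proposition3p6 (k : fieldType) (p : nat) (hp : p \in [pchar k])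
    (r s : nat) :
  (p <> 2%N ->
     forall P bP : nat -> Hodd k r s -> Hodd k r s, steenrod_odd p P bP ->
     forall I : Hodd k r s -> Prop,
       is_ideal I -> is_homogeneous (@odd_homog k r s) I ->
       (forall j, stable_under (P j) I) -> (forall j, stable_under (bP j) I) ->
       (exists u, [/\ I u, u <> 0 & odd_homog 2 u]) ->
       contains_product r (@odd_x k r s) (@odd_z k r s) I)
  /\
  (p = 2%N ->
     forall Sq : nat -> Htwo k r s -> Htwo k r s, steenrod_two Sq ->
     forall I : Htwo k r s -> Prop,
       is_ideal I -> is_homogeneous (@two_homog k r s) I ->
       (forall j, stable_under (Sq j) I) ->
       (exists u, [/\ I u, u <> 0 & two_homog 2 u]) ->
       contains_product r (@two_x k r s) (@two_z k r s) I).
Proof.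
split=> [_ P bP hS I I_ideal _ P_stable bP_stable|p2 Sq hS I I_ideal _ Sq_stable].
  exact: (contains_product_odd hp hS I_ideal P_stable bP_stable).
by subst p; apply: (contains_product_two hp hS I_ideal Sq_stable).
Qed.
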